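(* Let $\mathcal W$ be a measure matrix, $Q(x)=\prod_{i=1}^s(x-q_i)^{n_i}=Q_0+Q_1x+\dots+x^N$ with $\{q_i\}\cap\Omega=\varnothing$, and let $\check{\mathcal W}_L,\check{\mathcal W}_R$ be the Geronimus–Sobolev deformed measure matrices; assume $G_{\mathcal W},G_{\check{\mathcal W}_L},G_{\check{\mathcal W}_R}$ are $LU$-factorizable. For $Z\in\{L,R\}$ let $\Gamma_Z^{k}$ be the $N\times N$ upper triangular matrix $\mathrm{diag}\big((\check h_Z)_k^{-1},\dots,(\check h_Z)_{k+N-1}^{-1}\big)\cdot\big((\check\omega_Z)_{a,b}\big)_{k\le a\le k+N-1,\ k-N\le b\le k-1}$ (quantities with negative index being zero). Then for every $k\geq 1$ $$\check K_R^{[k]}(x,y)=Q(x)K^{[k]}(x,y)-\big((\check P_{2R})_k(x),\dots,(\check P_{2R})_{k+N-1}(x)\big)\,\Gamma_R^k\begin{pmatrix}(P_1)_{k-N}(y)\\ \vdots\\ (P_1)_{k-1}(y)\end{pmatrix},$$ $$\check K_L^{[k]}(x,y)=Q(y)K^{[k]}(x,y)-\big((\check P_{1L})_k(y),\dots,(\check P_{1L})_{k+N-1}(y)\big)\,\Gamma_L^k\begin{pmatrix}(P_2)_{k-N}(x)\\ \vdots\\ (P_2)_{k-1}(x)\end{pmatrix}.$$ Similarly, for every $k\ge N$ the mixed kernels satisfy $$Q(x)\mathcal K_2^{[k]}(x,y)-\big((\check P_{2R})_k(x),\dots,(\check P_{2R})_{k+N-1}(x)\big)\,\Gamma_R^k\begin{pmatrix}(C_1)_{k-N}(y)\\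 \vdots\\ (C_1)_{k-1}(y)\end{pmatrix}=Q(y)\check{\mathcal K}_{2R}^{[k]}(x,y)-\big(\chi^{[N]}(x)\big)^\top\mathbf Q^{[N]}\chi^{[N]}(y),$$ $$Q(y)\mathcal K_1^{[k]}(x,y)-\big((\check P_{1L})_k(y),\dots,(\check P_{1L})_{k+N-1}(y)\big)\,\Gamma_L^k\begin{pmatrix}(C_2)_{k-N}(x)\\ \vdots\\ (C_2)_{k-1}(x)\end{pmatrix}=Q(x)\check{\mathcal K}_{1L}^{[k]}(x,y)-\big(\chi^{[N]}(y)\big)^\top\mathbf Q^{[N]}\chi^{[N]}(x),$$ where the argument of the second kind functions lies outside $\Omega\cup\{q_i\}$.
   Context: Semi-infinite matrices and vectors are indexed from $0$; $A^{[k]}$ is the leading $k\times k$ truncation (first $k$ entries for a vector). A measure matrix of order $\mathcal N$ is a semi-infinite matrix $\mathcal W=(d\mu_{i,j})$ of (possibly signed) Borel measures with (closed) supports $\Omega_{i,j}\subseteq\mathbb R$, zero if $i>\mathcal N$ or $j>\mathcal N$; $\Omega=\bigcup\Omega_{i,j}$; $(f,h;\mathcal W)=\sum_{n,r}\int_{\Omega_{n,r}}f^{(n)}h^{(r)}d\mu_{n,r}$ (finite on polynomials); $(G_{\mathcal W})_{n,p}=(x^n,x^p;\mathcal W)$. A matrix $G$ is $LU$-factorizable if $\det G^{[k]}\neq0$ for all $k\ge1$; then uniquely $G=S_1^{-1}H(S_2^{-1})^\top$ with $S_1,S_2$ lower unitriangular, $H=\mathrm{diag}(h_0,h_1,\dots)$;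 $P_\alpha(x)=S_\alpha\chi(x)$, $\chi(x)=(1,x,x^2,\dots)^\top$. Second kind functions: $C_{1,l}(y)=(P_{1,l}(x),\tfrac1{y-x};\mathcal W)$, $C_{2,l}(y)=(\tfrac1{y-x},P_{2,l}(x);\mathcal W)$, $y\notin\Omega$ (assumed defined). Kernels: $K^{[l]}(x,y)=\sum_{k<l}P_{2,k}(x)h_k^{-1}P_{1,k}(y)$, $\mathcal K_1^{[l]}(x,y)=\sum_{k<l}C_{2,k}(x)h_k^{-1}P_{1,k}(y)$, $\mathcal K_2^{[l]}(x,y)=\sum_{k<l}P_{2,k}(x)h_k^{-1}C_{1,k}(y)$. $\mathcal X$ is the semi-infinite upper bidiagonal matrix with $\mathcal X_{n,n}=x$, $\mathcal X_{n,n+1}=n+1$; $Q(\mathcal X)$ is upper triangular with $Q(\mathcal X)_{n,n+i}=\binom{n+i}{i}Q^{(i)}(x)$, invertible on $\Omega$. Geronimus–Sobolev deformations: $\check{\mathcal W}_L:=[Q(\mathcal X)]^{-1}\mathcal W+\sum_{i=1}^s\xi^{(i)}\delta(x-q_i)dx$, $\check{\mathcal W}_R:=\mathcal W[Q(\mathcal X^\top)]^{-1}+\sum_{i=1}^s\xi^{(i)}\delta(x-q_i)dx$, with $\xi^{(i)}$ an $n_i\times n_i$ matrix of free real parameters placed in rows and columns $0,\dots,n_i-1$. One has $G_{\mathcal W}=Q(\Lambda)G_{\check{\mathcal W}_L}=G_{\check{\mathcal W}_R}Q(\Lambda)^\top$, with $\Lambda_{i,j}=\delta_{i+1,j}$.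 Objects associated with $\check{\mathcal W}_L$ (resp. $\check{\mathcal W}_R$) carry a check and index $L$ (resp. $R$). Resolvents: $\check\omega_L:=\check S_{2L}S_2^{-1}$, $\check\omega_R:=\check S_{1R}S_1^{-1}$ (lower unitriangular with at most $N$ nonzero subdiagonals). $\mathbf Q_{i,j}=Q_{i+j+1}$ with $Q_N=1$, $Q_l=0$ for $l>N$. *)

(* Defs.v *)
From HB Require Import structures.
From mathcomp Require Import all_boot all_order all_algebra.
From mathcomp Require Import all_classical all_reals all_analysis.
From mathcomp Require Import complex.

Set Implicit Arguments.
Unset Strict Implicit.
Unset Printing Implicit Defensive.

Import Order.TTheory GRing.Theory Num.Theory.
Import numFieldNormedType.Exports.

Local Open Scope classical_set_scope.
Local Open Scope complex_scope.
Local Open Scope ring_scope.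

Definition smx (R : Type) := nat -> nat -> R.

Definition trunc (R : Type) (k : nat) (A : smx R) : 'M[R]_k :=
  \matrix_(i < k, j < k) A i j.

Definition strmx (R : Type) (A : smx R) : smx R := fun i j => A j i.

Section SemiInfinite.
Variable R : fieldType.

Definition sdiag (h : nat -> R) : smx R := fun i j => if i == j then h i else 0.

(* Product with a LOWER TRIANGULAR left factor, so that column indices beyond
   i do not contribute to row i. *)
Definition lmul (A B : smx R) : smx R :=
  fun i j => \sum_(k < i.+1) A i k * B k j.

Definition lower_unitriangular (S : smx R) :=
  (forall i, S i i = 1) /\ (forall i j, (i < j)%N -> S i j = 0).

(* For TRIANGULAR matrices (lower or upper), leading truncations commute with
   products, hence with polynomials and with inverses; the entry (i, j) can
   therefore be read off any truncation that contains it. *)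
Definition tri_inv (A : smx R) : smx R := fun i j =>
  invmx (trunc (maxn i j).+1 A) (inord i) (inord j).

Definition tri_horner (Q : {poly R}) (A : smx R) : smx R := fun i j =>
  horner_mx (trunc (maxn i j).+1 A) Q (inord i) (inord j).

Definition LU_factorizable (G : smx R) :=
  forall k, (0 < k)%N -> \det (trunc k G) != 0.

Record LU_data := LUData {
  lu_S1 : smx R ;
  lu_h : nat -> R ;
  lu_S2 : smx R }.

(* G = S1^-1 H (S2^-1)^T *)
Definition is_LU (G : smx R) (F : LU_data) :=
  [/\ lower_unitriangular (lu_S1 F),
      lower_unitriangular (lu_S2 F) &
      forall i j, G i j =
        lmul (tri_inv (lu_S1 F))
          (lmul (sdiag (lu_h F)) (strmx (tri_inv (lu_S2 F)))) i j].

Definition biorth_poly (S : smx R) (l : nat) : {poly R} :=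
  \poly_(j < l.+1) S l j.

(* Right multiplication by calX x turns the row of derivatives at x of f into
   the row of derivatives at x of the product of f by the identity function. *)
Definition calX (x : R) : smx R := fun n m =>
  if m == n then x else if m == n.+1 then n.+1%:R else 0.

Lemma tri_horner_calX (Q : {poly R}) (x : R) (n m : nat) :
  tri_horner Q (calX x) n m =
  if (n <= m)%N then (Q^`(m - n)).[x] *+ 'C(m, m - n) else 0.
Proof.
rewrite /tri_horner; set K := maxn n m.
suff H (i j : 'I_K.+1) : horner_mx (trunc K.+1 (calX x)) Q i j =
    if (i <= j)%N then (Q^`(j - i)).[x] *+ 'C(j, j - i) else 0.
  by rewrite H !inordK // ltnS ?leq_maxl ?leq_maxr.
elim/poly_ind: Q i j => [|p c IH] i j.
  by rewrite rmorph0 mxE; case: ifP => // _; rewrite linear0 horner0 mul0rn.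
rewrite rmorphD rmorphM /= horner_mx_X horner_mx_C mxE -mulmxE !mxE.
rewrite (bigD1 j) //= mxE /calX eqxx IH.
have -> : \sum_(l < K.+1 | l != j) horner_mx (trunc K.+1 (calX x)) p i l *
      trunc K.+1 (calX x) l j =
    if (i < j)%N then (p^`(j - i.+1)).[x] *+ ('C(j.-1, j - i.+1) * j) else 0.
  case: j => [[|j] jK] /=.
    rewrite big1 // => l /negPf lj; rewrite !mxE /calX /=.
    by case: eqP => [e|]; [case/eqP: (negbT lj); apply: val_inj|rewrite mulr0].
  have jK' : (j < K.+1)%N by apply: ltnW.
  rewrite (bigD1 (Ordinal jK')) /=; last by rewrite -val_eqE /= ltn_eqF.
  rewrite big1 ?addr0 => [|l /andP[lj lj']].
    rewrite IH mxE /calX /= eqxx gtn_eqF ?ltnSn// ltnS subSS.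
    by case: ifP => _; rewrite ?mul0r// mulrnA mulr_natr.
  rewrite !mxE /calX.
  have -> : (j.+1 == l) = false.
    by apply/negbTE; apply: contra lj => /eqP e; apply/eqP/val_inj.
  have -> : (j.+1 == l.+1) = false.
    by apply/negbTE; apply: contra lj' => /eqP[e]; apply/eqP/val_inj.
  by rewrite mulr0.
case: (ltngtP i j) => [ij|ij|ij].
- have ji : (j - i = (j - i.+1).+1)%N by rewrite subnS prednK ?subn_gt0.
  have -> : (i == j) = false by apply/negbTE; rewrite -val_eqE /= ltn_eqF.
  have -> : ('C(j.-1, j - i.+1) * j = (j - i) * 'C(j, j - i))%N.
    by rewrite mulnC ji mul_bin_diag.
  rewrite mulr0n addr0 ji derivnMXaddC hornerD hornerMn hornerMX mulrnDl.
  by rewrite addrC mulrnA mulrnAl.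
- have -> : (i == j) = false by apply/negbTE; rewrite -val_eqE /= gtn_eqF.
  by rewrite mulr0n mul0r !addr0.
- have -> : i = j by apply: val_inj.
  by rewrite eqxx subnn !derivn0 bin0 !mulr1n hornerMXaddC addr0.
Qed.

Definition mx_ext k (A : 'M[R]_k) : smx R := fun n r =>
  match insub n, insub r with Some a, Some b => A a b | _, _ => 0 end.

End SemiInfinite.

(* Sequences extended to int: quantities of negative index are zero. *)
Definition zext (V : nmodType) (u : nat -> V) (z : int) : V :=
  if z is Posz n then u n else 0.

Section Charges.
Variable R : realType.
Local Notation T := (measurableTypeR R).

Definition signed_measure := {charge set T -> \bar R}.

(* A chosen Hahn decomposition; the Jordan parts do not depend on the choice. *)
Definition hahn_sets (nu : signed_measure) :
    {PN : set T * set T | hahn_decomposition nu PN.1 PN.2} :=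
  cid (let: ex_intro P (ex_intro N PN) := Hahn_decomposition nu in
       ex_intro (fun PN : set T * set T => hahn_decomposition nu PN.1 PN.2)
         (P, N) PN).

Definition cpos (nu : signed_measure) : {finite_measure set T -> \bar R} :=
  jordan_pos (svalP (hahn_sets nu)).

Definition cneg (nu : signed_measure) : {finite_measure set T -> \bar R} :=
  jordan_neg (svalP (hahn_sets nu)).

Definition cvariation (nu : signed_measure) : {measure set T -> \bar R} :=
  charge_variation (svalP (hahn_sets nu)).

Definition csupport (nu : signed_measure) : set R :=
  [set x | forall U : set R, open_nbhs x U -> cvariation nu U != 0%E].

Definition cintegrable (nu : signed_measure) (D : set R) (f : R -> R) : Prop :=
  (cvariation nu).-integrable D (EFin \o f).

Definition cintegral (nu : signed_measure) (D : set R) (f : R -> R) : R :=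
  Rintegral (cpos nu) D f - Rintegral (cneg nu) D f.

Definition csum2 (n1 n2 : signed_measure) : signed_measure := cadd n1 n2.

Definition cnull : signed_measure := czero.

Definition csm (r : R) (nu : signed_measure) : signed_measure := cscale r nu.

Definition cdirac (a : R) : signed_measure :=
  charge_of_finite_measure (dirac (a : T)).

(* The signed measure f d(nu); junk value 0 when f is not nu-integrable. *)
Definition cdensity (f : R -> R) (nu : signed_measure) : signed_measure :=
  match pselect ((cpos nu).-integrable setT (EFin \o f)),
        pselect ((cneg nu).-integrable setT (EFin \o f)) with
  | left fp, left fn => csum2 (induced_charge fp) (csm (-1) (induced_charge fn))
  | _, _ => cnull
  end.

(* mm_order is the largest row or column index that may carry a measure. *)
Record measure_matrix := MeasureMatrix {
  mm_order : nat ;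
  mm_entry :> nat -> nat -> signed_measure }.

(* The second condition is finiteness of (f, h; W) on polynomials. *)
Definition is_measure_matrix (W : measure_matrix) : Prop :=
  (forall n r, (mm_order W < n)%N || (mm_order W < r)%N ->
     forall A, measurable A -> W n r A = 0%E) /\
  (forall (f h : {poly R}) (n r : nat),
     cintegrable (W n r) (csupport (W n r))
       (fun x => (f^`(n)).[x] * (h^`(r)).[x])).

Definition mm_support (W : measure_matrix) : set R :=
  [set x | exists n r, csupport (W n r) x].

Definition sform (W : measure_matrix) (f h : R -> R) : R :=
  \sum_(n < (mm_order W).+1) \sum_(r < (mm_order W).+1)
    cintegral (W n r) (csupport (W n r))
      (fun x => (f^`(n))%classic x * (h^`(r))%classic x).

(* The C-bilinear extension to complex-valued functions of a real variable. *)
Definition csform (W : measure_matrix) (f h : R -> R[i]) : R[i] :=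
  (sform W (fun x => complex.Re (f x)) (fun x => complex.Re (h x))
   - sform W (fun x => complex.Im (f x)) (fun x => complex.Im (h x)))
  +i* (sform W (fun x => complex.Re (f x)) (fun x => complex.Im (h x))
   + sform W (fun x => complex.Im (f x)) (fun x => complex.Re (h x))).

Definition gram (W : measure_matrix) : smx R := fun n p =>
  sform W (fun x => x ^+ n) (fun x => x ^+ p).

Section Geronimus.
Variables (s : nat) (q : 'I_s -> R) (m : 'I_s -> nat).

Definition defQ : {poly R} := \prod_(i < s) ('X - (q i)%:P) ^+ m i.

Definition degQ : nat := \sum_(i < s) m i.

Variable xi : forall i : 'I_s, 'M[R]_(m i).

Definition mass_entry (n r : nat) : signed_measure :=
  \big[csum2/cnull]_(i < s) csm (mx_ext (xi i) n r) (cdirac (q i)).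

Definition geronimus_order (W : measure_matrix) : nat :=
  maxn (mm_order W) (\max_(i < s) (m i).-1).

(* The sums over j below run over the indices that may carry a measure of W. *)
Definition geronimusL (W : measure_matrix) : measure_matrix :=
  MeasureMatrix (geronimus_order W) (fun n r =>
    csum2
      (\big[csum2/cnull]_(j < (mm_order W).+1)
         cdensity (fun x => tri_inv (tri_horner defQ (calX x)) n j) (W j r))
      (mass_entry n r)).

Definition geronimusR (W : measure_matrix) : measure_matrix :=
  MeasureMatrix (geronimus_order W) (fun n r =>
    csum2
      (\big[csum2/cnull]_(j < (mm_order W).+1)
         cdensity (fun x => tri_inv (tri_horner defQ (strmx (calX x))) j r)
           (W n j))
      (mass_entry n r)).

(* chi^[N](x)^T bQ^[N] chi^[N](y), with bQ_(i,j) = Q_(i+j+1). *)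
Definition bezoutQ (x y : R[i]) : R[i] :=
  ((\row_(j < degQ) x ^+ j)
   *m (\matrix_(i < degQ, j < degQ) (defQ`_(i + j).+1)%:C)
   *m (\col_(j < degQ) y ^+ j)) ord0 ord0.

End Geronimus.

Definition peval (p : {poly R}) (z : R[i]) : R[i] :=
  (map_poly (real_complex R) p).[z].

Section Kernels.
Variables (W : measure_matrix) (F : LU_data R).

Definition P1 (l : nat) : {poly R} := biorth_poly (lu_S1 F) l.
Definition P2 (l : nat) : {poly R} := biorth_poly (lu_S2 F) l.

Definition cauchy (y : R[i]) : R -> R[i] := fun t => (y - t%:C)^-1.

Definition C1 (l : nat) (y : R[i]) : R[i] :=
  csform W (fun t => ((P1 l).[t])%:C) (cauchy y).
Definition C2 (l : nat) (y : R[i]) : R[i] :=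
  csform W (cauchy y) (fun t => ((P2 l).[t])%:C).

Definition kerK (l : nat) (x y : R[i]) : R[i] :=
  \sum_(k < l) peval (P2 k) x * ((lu_h F k)^-1)%:C * peval (P1 k) y.
Definition kerK1 (l : nat) (x y : R[i]) : R[i] :=
  \sum_(k < l) C2 k x * ((lu_h F k)^-1)%:C * peval (P1 k) y.
Definition kerK2 (l : nat) (x y : R[i]) : R[i] :=
  \sum_(k < l) peval (P2 k) x * ((lu_h F k)^-1)%:C * C1 k y.

End Kernels.

Definition resolventL (F FL : LU_data R) : smx R :=
  lmul (lu_S2 FL) (tri_inv (lu_S2 F)).
Definition resolventR (F FR : LU_data R) : smx R :=
  lmul (lu_S1 FR) (tri_inv (lu_S1 F)).

(* Column j of the second factor is column k - N + j of the resolvent omega;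
   h is the diagonal of the deformed factorization. *)
Definition Gamma (h : nat -> R) (omega : smx R) (N k : nat) : 'M[R]_N :=
  diag_mx (\row_(i < N) (h (k + i)%N)^-1)
  *m \matrix_(i < N, j < N) zext (omega (k + i)%N) (k%:Z - N%:Z + j%:Z).

(* (u_k, ..., u_(k+N-1)) Gam (v_(k-N), ..., v_(k-1))^T *)
Definition sandwich (N k : nat) (u : nat -> R[i]) (Gam : 'M[R]_N)
    (v : nat -> R[i]) : R[i] :=
  ((\row_(i < N) u (k + i)%N)
   *m map_mx (real_complex R) Gam
   *m (\col_(j < N) zext v (k%:Z - N%:Z + j%:Z))) ord0 ord0.

End Charges.

(* Main.v *)
Require Import Defs.
From mathcomp Require Import all_boot all_order all_algebra.
From mathcomp Require Import all_classical all_reals all_analysis.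
From mathcomp Require Import measurable_realfun.
From mathcomp Require Import complex ring lra zify.

Set Implicit Arguments.
Unset Strict Implicit.
Unset Printing Implicit Defensive.

Import Order.TTheory GRing.Theory Num.Theory.
Import numFieldNormedType.Exports.

Local Open Scope complex_scope.
Local Open Scope ring_scope.

(** The four identities express one computation.  Write [B(f, h)] for the
    bilinear form of a measure matrix, [p_a, p'_a] and [c_a, c'_a] for its two
    biorthogonal families and for those of the deformed one on the right.  The
    inverse of [Q(X)] in the deformation is chosen so that dividing the measure
    matrix by [Q(X)] undoes the multiplication of the second argument by [Q]:
    since the Leibniz rule turns the derivatives of [h] into those of [Q h]
    through the same triangular matrix, and since [Q] and its first derivatives
    vanish at the added masses, one gets [B'(f, Q h) = B(f, h)], both for
    polynomials [h] and for the Cauchy kernel [1 / (y - x)]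
    ([Lform_geronimusR], [form_geronimusR]).

    Consequently [Q p'_j = \sum_a omega(a,j) h_j / h'_a c'_a], where [omega] is
    the resolvent, which also maps the family [p] to the family [c]; [omega] is
    lower triangular, and banded because [Q p'_j] has degree [j + N].  Summing
    [Q(x) p'_j(x) v_j / h_j] over [j < k], for an arbitrary sequence [v], and
    exchanging the two sums, the indices [a < k] produce
    [\sum_b omega(a,b) v_b], and the indices [k <= a < k + N] produce the
    product with the matrix [Gamma] ([deformed_kernel], [resolvent_kernel]).
    With [v = p(y)] this is the identity for the kernels [K].

    With [v = C_1(y)] one needs [\sum_b omega(a,b) C_{1,b}(y)], that is the
    second kind function of [c_a] for the original measure matrix.  The
    decomposition [Q(y) / (y - x) = Q(x) / (y - x) + (Q(y) - Q(x)) / (y - x)],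
    whose last term is the Bezout polynomial, gives
    [Q(y) B'(c_a, 1/(y - x)) - B'(c_a, Bezout(., y))]
    ([second_kind_geronimusR]).  If [N <= k], the kernel of order [k]
    reproduces polynomials of degree less than [N], so that the sum of the
    last terms over [a < k] is the Bezout polynomial at [x].

    The left deformation is the right deformation of the transposed measure
    matrix ([mm_transpose_geronimusL]), which exchanges the two families.

    The analytic part computes integrals against the deformed measures.  The
    Jordan decomposition is not additive, so all the charges of one row are
    given densities with respect to a common finite measure, and integrals
    against a charge become integrals of products with its density
    ([density_integral], [cintegral_entry]).  Integrability is organized around
    functions dominated by a polynomial on the supports: rational functions
    without poles there are such, since supports are closed. *)

(** * Charges with a density with respect to a finite measure *)

Section Density.
Context d (T : measurableType d) (R : realType).
Local Open Scope classical_set_scope.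
Local Open Scope ereal_scope.
Implicit Types (mu m : {finite_measure set T -> \bar R}).

(** A nonnegative density agrees almost everywhere with the Radon-Nikodym
    derivative, for which the change of variables is known. *)
Lemma integral_density mu m (r : T -> R) (D : set T) (f : T -> \bar R) :
  m.-integrable setT (EFin \o r) -> (forall x, (0 <= r x)%R) ->
  (forall A, measurable A -> mu A = \int[m]_(x in A) (r x)%:E) ->
  measurable D -> measurable_fun D f -> (forall x, 0 <= f x) ->
  \int[mu]_(x in D) f x = \int[m]_(x in D) (f x * (r x)%:E).
Proof.
move=> ir r0 muE mD mf f0.
have dom : mu `<< m.
  apply/null_content_dominatesP => A mA mA0; rewrite muE//.
  apply: null_set_integral => //.
  by apply: measurable_funTS; exact: measurable_int ir.
rewrite -(Radon_Nikodym_SigmaFinite.change_of_variables dom)//.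
have mr : measurable_fun D (EFin \o r).
  by apply: measurable_funTS; exact: measurable_int ir.
have mrn : measurable_fun D (Radon_Nikodym_SigmaFinite.f mu m).
  apply: measurable_funTS.
  exact: measurable_int (Radon_Nikodym_SigmaFinite.f_integrable dom).
apply: ae_eq_integral => //.
- exact: emeasurable_funM.
- exact: emeasurable_funM.
- apply: ae_eqe_mul2l; apply: integral_ae_eq => //.
    apply: (integrableS measurableT) => //.
    exact: Radon_Nikodym_SigmaFinite.f_integrable.
  by move=> A AD mA; rewrite -Radon_Nikodym_SigmaFinite.f_integral// muE.
Qed.

Lemma integral_densityE mu m (r : T -> R) (D : set T) (f : T -> R) :
  m.-integrable setT (EFin \o r) -> (forall x, (0 <= r x)%R) ->
  (forall A, measurable A -> mu A = \int[m]_(x in A) (r x)%:E) ->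
  measurable D -> measurable_fun D f ->
  (mu.-integrable D (EFin \o f) <->
   m.-integrable D (EFin \o (fun x => f x * r x)%R)) /\
  \int[mu]_(x in D) (f x)%:E = \int[m]_(x in D) (f x * r x)%:E.
Proof.
move=> ir r0 muE mD mf.
have mEf : measurable_fun D (EFin \o f) by exact/measurable_EFinP.
have mr : measurable_fun D r.
  by apply/measurable_EFinP/measurable_funTS; exact: measurable_int ir.
have mfr : measurable_fun D (EFin \o (fun x => f x * r x)%R).
  by apply/measurable_EFinP; exact: measurable_funM.
split.
  have intE : \int[mu]_(x in D) `|(EFin \o f) x| =
              \int[m]_(x in D) `|(EFin \o (fun x => f x * r x)%R) x|.
    rewrite (integral_density ir r0 muE)//; last exact: measurableT_comp.
    apply: eq_integral => x _ /=.
    by rewrite -EFinM normrM (ger0_norm (r0 x)).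
  by split => /integrableP[_ h]; apply/integrableP; split => //;
    [rewrite -intE|rewrite intE].
rewrite integralE [RHS]integralE.
rewrite (integral_density ir r0 muE)//; last exact: measurable_funepos.
rewrite (integral_density ir r0 muE)//; last exact: measurable_funeneg.
have r0' x : 0 <= (r x)%:E by rewrite lee_fin.
congr (_ - _); apply: eq_integral => x _; rewrite ?funeposE ?funenegE /=.
  by rewrite maxe_pMl// mul0e.
by rewrite maxe_pMl// mul0e -mulNr EFinM.
Qed.

Definition density m (nu : {charge set T -> \bar R}) (g : T -> R) :=
  m.-integrable setT (EFin \o g) /\
  forall A, measurable A -> nu A = \int[m]_(x in A) (g x)%:E.

(** The sets where the density is nonnegative or negative form a Hahn
    decomposition, and all Hahn decompositions split a charge in the same way. *)
Lemma density_jordan m (nu : {charge set T -> \bar R}) (g : T -> R) P N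
    (nuPN : hahn_decomposition nu P N) : density m nu g ->
  forall A, measurable A ->
    jordan_pos nuPN A = \int[m]_(x in A) (Num.max (g x) 0)%:E /\
    jordan_neg nuPN A = \int[m]_(x in A) (Num.max (- g x) 0)%:E.
Proof.
move=> [ig nuE] A mA.
have mg : measurable_fun setT g.
  by apply/measurable_EFinP; exact: measurable_int ig.
pose P' := [set x : T | (0 <= g x)%R]; pose N' := [set x : T | (g x < 0)%R].
have mP' : measurable P'.
  rewrite (_ : P' = setT `&` [set x | (cst 0 x <= g x)%R]); last first.
    by rewrite setTI.
  by apply: measurable_fun_le.
have NE : N' = ~` P'.
  apply/seteqP; split => x /=; rewrite /N' /P' /= ltNge; last by move/negP.
  by move=> /negP.
have mN' : measurable N' by rewrite NE; exact: measurableC.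
have hPN : hahn_decomposition nu P' N'.
  split.
  - split => // B mB BP; rewrite nuE//; apply: integral_ge0 => x Bx.
    by rewrite lee_fin; exact: BP.
  - split => // B mB BN; rewrite nuE//.
    rewrite -leeN2 oppe0 -integralN/=; last first.
      apply: integrable_add_def => //.
      exact: (integrableS measurableT mB (@subsetT _ _) ig).
    apply: integral_ge0 => x Bx; rewrite lee_fin oppr_ge0 ltW//.
    exact: BN.
  - by rewrite NE setUv.
  - by rewrite NE setICr.
have [nP nN] := Hahn_decomposition_uniq nuPN hPN mA.
split.
  rewrite jordan_posE cjordan_posE /crestr0 mem_set// /crestr nP.
  rewrite nuE; last exact: measurableI.
  rewrite integral_mkcondr; apply: eq_integral => x _; rewrite patchE.
  case: ifPn => [/set_mem xP|/negP xP]; first by rewrite max_l.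
  rewrite max_r//; apply/ltW; rewrite ltNge; apply/negP => g0.
  by apply: xP; apply/mem_set.
rewrite jordan_negE cjordan_negE /crestr0 mem_set// /crestr nN.
rewrite nuE; last exact: measurableI.
rewrite -integralN/=; last first.
  have mAN : measurable (A `&` N') by exact: measurableI.
  apply: integrable_add_def => //.
  exact: (integrableS measurableT mAN (@subsetT _ _) ig).
rewrite integral_mkcondr; apply: eq_integral => x _; rewrite patchE.
case: ifPn => [/set_mem xP|/negP xP].
  by rewrite max_l// oppr_ge0 ltW.
rewrite max_r// oppr_le0 leNgt; apply/negP => g0.
by apply: xP; apply/mem_set.
Qed.

Lemma integrable_charge_variation (nu : {charge set T -> \bar R}) P N
    (nuPN : hahn_decomposition nu P N) (D : set T) (f : T -> R) :
  measurable D ->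
  (charge_variation nuPN).-integrable D (EFin \o f) <->
    (jordan_pos nuPN).-integrable D (EFin \o f) /\
    (jordan_neg nuPN).-integrable D (EFin \o f).
Proof.
move=> mD.
have vE : measurable_fun D (EFin \o f) ->
    \int[charge_variation nuPN]_(x in D) `|(EFin \o f) x| =
    \int[jordan_pos nuPN]_(x in D) `|(EFin \o f) x| +
    \int[jordan_neg nuPN]_(x in D) `|(EFin \o f) x|.
  move=> mf; rewrite -ge0_integral_measure_add//; last exact: measurableT_comp.
  by apply: eq_measure_integral => A _ _; exact/esym/measure_addE.
split => [/integrableP[mf]|[/integrableP[mf h1] /integrableP[_ h2]]].
  by rewrite vE// => h; split; apply/integrableP; split => //;
    apply: le_lt_trans h; rewrite ?leeDl ?leeDr//; exact: integral_ge0.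
by apply/integrableP; split => //; rewrite vE// lte_add_pinfty.
Qed.

(** This is what makes integration additive in the charge: the Jordan parts
    of a sum are not the sums of the Jordan parts, but densities add up. *)
Lemma density_integral m (nu : {charge set T -> \bar R}) (g : T -> R) P N
    (nuPN : hahn_decomposition nu P N) (D : set T) (f : T -> R) :
  density m nu g -> measurable D -> measurable_fun D f ->
  ((charge_variation nuPN).-integrable D (EFin \o f) <->
    m.-integrable D (EFin \o (fun x => f x * g x)%R)) /\
  ((charge_variation nuPN).-integrable D (EFin \o f) ->
   Rintegral (jordan_pos nuPN) D f - Rintegral (jordan_neg nuPN) D f =
   Rintegral m D (fun x => f x * g x))%R.
Proof.
move=> gnu mD mf; have [ig nuE] := gnu.
have mg : measurable_fun setT g.
  by apply/measurable_EFinP; exact: measurable_int ig.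
have mgD : measurable_fun D g by exact: measurable_funTS.
pose gp x := Num.max (g x) 0%R; pose gn x := Num.max (- g x)%R 0%R.
have igp : m.-integrable setT (EFin \o gp).
  apply: le_integrable ig => //.
    by apply/measurable_EFinP; exact: measurable_maxr.
  move=> x _ /=; rewrite lee_fin /gp; case: (leP (g x) 0%R) => h.
    by rewrite normr0.
  by [].
have ign : m.-integrable setT (EFin \o gn).
  apply: le_integrable ig => //.
    apply/measurable_EFinP; apply: measurable_maxr => //.
    exact: measurableT_comp.
  move=> x _ /=; rewrite lee_fin /gn; case: (leP (- g x)%R 0%R) => h.
    by rewrite normr0.
  by rewrite normrN.
have gp0 x : (0 <= gp x)%R by rewrite /gp le_max lexx orbT.
have gn0 x : (0 <= gn x)%R by rewrite /gn le_max lexx orbT.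
have pE A (mA : measurable A) := (density_jordan nuPN gnu mA).1.
have nE A (mA : measurable A) := (density_jordan nuPN gnu mA).2.
have [ip Ip] := integral_densityE igp gp0 pE mD mf.
have [in_ In] := integral_densityE ign gn0 nE mD mf.
have mEf : measurable_fun D (EFin \o f) by exact/measurable_EFinP.
have gE x : g x = (gp x - gn x)%R.
  rewrite /gp /gn; case: (leP (g x) 0%R) => h.
    by rewrite max_l ?oppr_ge0// sub0r opprK.
  by rewrite max_r ?subr0// oppr_le0 ltW.
have vint := integrable_charge_variation nuPN f mD.
have mfg : measurable_fun D (EFin \o (fun x => f x * g x)%R).
  by apply/measurable_EFinP; exact: measurable_funM.
have fgE : (fun x => f x * g x)%R = (fun x => f x * gp x - f x * gn x)%R.
  by apply/funext => x; rewrite gE mulrBr.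
split.
  apply: (iff_trans vint); split=> [[/ip i1 /in_ i2]|i].
    by rewrite fgE; apply: (integrableB mD i1 i2).
  split; [apply/ip|apply/in_]; apply: le_integrable i => //.
  - apply/measurable_EFinP/measurable_funM => //.
    by apply: measurable_funTS; apply/measurable_EFinP; exact: measurable_int igp.
  - move=> x _; rewrite /= lee_fin !normrM ler_wpM2l// /gp.
    by case: (leP (g x) 0%R) => h; rewrite ?normr0.
  - apply/measurable_EFinP/measurable_funM => //.
    by apply: measurable_funTS; apply/measurable_EFinP; exact: measurable_int ign.
  - move=> x _; rewrite /= lee_fin !normrM ler_wpM2l// /gn.
    by case: (leP (- g x)%R 0%R) => h; rewrite ?normr0 ?normrN.
move=> /vint[/ip i1 /in_ i2].
by rewrite {1 2}/Rintegral Ip In fgE RintegralB.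
Qed.

Lemma density_exists m (nu : {charge set T -> \bar R}) :
  nu `<< m -> exists g, density m nu g.
Proof.
move=> num; exists (fine \o Radon_Nikodym nu m).
have E : EFin \o (fine \o Radon_Nikodym nu m) = Radon_Nikodym nu m.
  by apply/funext => x /=; rewrite fineK//; exact: Radon_Nikodym_fin_num.
split; first by rewrite E; exact: Radon_Nikodym_integrable.
move=> A mA; rewrite (Radon_Nikodym_integral num mA).
by apply: eq_integral => x _; rewrite -E.
Qed.

Lemma jordan_nonneg (nu : {charge set T -> \bar R}) P N
    (nuPN : hahn_decomposition nu P N) :
  (forall A, measurable A -> 0 <= nu A) ->
  forall A, measurable A -> jordan_neg nuPN A = 0 /\ jordan_pos nuPN A = nu A.
Proof.
move=> nu0 A mA.
have mN : measurable N by case: (nuPN) => _ [].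
have jn0 : jordan_neg nuPN A = 0.
  rewrite jordan_negE cjordan_negE /crestr0 mem_set// /crestr.
  suff -> : nu (A `&` N) = 0 by rewrite oppe0.
  apply/eqP; rewrite eq_le nu0 ?andbT; last exact: measurableI.
  by case: (nuPN) => _ [_ + _ _]; apply => //; exact: measurableI.
split=> //; rewrite (jordan_decomp nuPN mA) /cadd/= cscaleN1.
by rewrite -[LHS]adde0 -oppe0 -jn0.
Qed.

(** Finitely many charges are handled together by giving each a density with
    respect to the sum of their variations. *)
Lemma dominating_measure n (nu : nat -> charge T R) :
  exists m, forall i, (i < n)%N -> nu i `<< m.
Proof.
elim: n => [|n [m IH]]; first by exists mzero.
have [P [N nuPN]] := Hahn_decomposition (nu n).
have [v vE] : exists v : {finite_measure set T -> \bar R},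
    forall A, measurable A -> v A = m A + charge_variation nuPN A.
  pose c := cadd (charge_of_finite_measure m) (charge_variation nuPN).
  have [P' [N' cPN]] := Hahn_decomposition c.
  exists (jordan_pos cPN) => A mA.
  have c0 B : measurable B -> 0 <= c B.
    by move=> _; apply: adde_ge0; exact: measure_ge0.
  exact: (jordan_nonneg cPN c0 mA).2.
exists v => i; rewrite ltnS leq_eqVlt => /predU1P[->|] /=.
  apply/(null_charge_dominatesP nuPN) => A mA vA0.
  have /eqP := etrans (esym (vE A mA)) vA0.
  by rewrite padde_eq0// => /andP[_ /eqP].
move/IH => /null_content_dominatesP h; apply/null_content_dominatesP => A mA vA0.
have /eqP := etrans (esym (vE A mA)) vA0.
rewrite padde_eq0// => /andP[/eqP + _]; exact: h.
Qed.

End Density.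

(** * Supports of signed measures *)

Section ChargeSupport.
Variable R : realType.
Local Open Scope classical_set_scope.
Local Open Scope ereal_scope.
Local Notation T := (measurableTypeR R).
Implicit Types (nu : signed_measure R) (D : set T).

Lemma csupportCP nu x : (~` csupport nu) x <->
  exists U, [/\ open U, U x & cvariation nu U = 0].
Proof.
split.
  move=> /existsNP[U /not_implyP[[oU Ux] /negP/negPn/eqP U0]].
  by exists U.
by move=> [U [oU Ux U0]] /(_ U (conj oU Ux)); rewrite U0 eqxx.
Qed.

Lemma csupport_closed nu : closed (csupport nu).
Proof.
rewrite -[X in closed X]setCK; apply: open_closedC.
rewrite openE => x /csupportCP[U [oU Ux U0]].
have : nbhs x U by exact: open_nbhs_nbhs.
by apply: filterS => y Uy; apply/csupportCP; exists U.
Qed.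

Lemma csupport_measurable nu :
  measurable (csupport nu : set T).
Proof. by apply: closed_measurable; exact: csupport_closed. Qed.

(** The complement of the support is a union of countably many null balls with
    rational centers and radii. *)
Lemma csupportC_null nu : cvariation nu (~` csupport nu) = 0.
Proof.
apply: measure_negligible; first by apply: measurableC; exact: csupport_measurable.
pose b (cr : rat * rat) : set R := ball (@ratr R cr.1) (ratr cr.2).
(* An enumeration by [nat] of the null balls with rational data. *)
pose B n := if unpickle n is Some cr then
  if cvariation nu (b cr) == 0 then b cr else set0 else set0.
have mb cr : measurable (b cr : set T).
  exact: measurable_ball.
have nB n : (cvariation nu).-negligible (B n).
  rewrite /B; case: unpickle => [cr|]; last exact: negligible_set0.
  case: eqP => [e|_]; last exact: negligible_set0.
  exact/negligibleP.
apply: negligibleS (negligible_bigcup nB) => x /csupportCP[U [oU Ux U0]].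
have [c [r [/set_mem xB BU]]] := open_subball_rat oU (mem_set Ux).
exists (pickle (c, r)); first exact: I.
rewrite /B pickleK.
suff -> : cvariation nu (b (c, r)) = 0 by rewrite eqxx.
apply/eqP; rewrite -measure_le0 -U0.
by apply: le_measure => //; rewrite inE; [exact: mb|exact: open_measurable].
Qed.

(** To bound the support of a deformed measure it suffices to evaluate the
    charge, whose expression is explicit, rather than its variation. *)
Lemma csupport_sub nu D : closed (D : set R) ->
  (forall A, measurable A -> A `<=` ~` D -> nu A = 0) -> csupport nu `<=` D.
Proof.
move=> cD nu0 x; apply: contraPP => Dx.
apply/csupportCP; exists (~` D); split => //; first exact: closed_openC.
have mDC : measurable (~` D) by apply: measurableC; exact: closed_measurable.
case: (svalP (hahn_sets nu)) => -[mP _] [mN _] _ _.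
have p0 : cpos nu (~` D) = 0.
  apply: (etrans (jordan_posE (svalP (hahn_sets nu)) _)).
  rewrite cjordan_posE /crestr0 mem_set// /crestr.
  by rewrite nu0//; exact: measurableI.
have n0 : cneg nu (~` D) = 0.
  apply: (etrans (jordan_negE (svalP (hahn_sets nu)) _)).
  rewrite cjordan_negE /crestr0 mem_set// /crestr.
  by rewrite nu0 ?oppe0//; exact: measurableI.
by change (cpos nu (~` D) + cneg nu (~` D) = 0); rewrite p0 n0 adde0.
Qed.

Lemma csupport_null nu : (forall A, measurable A -> nu A = 0) ->
  csupport nu = set0.
Proof.
move=> nu0; have S0 : csupport nu `<=` set0.
  by apply: csupport_sub => [|A mA _]; [exact: closed0|exact: nu0].
by apply/seteqP; split.
Qed.

Lemma jordan_null nu A : measurable A -> cvariation nu A = 0 ->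
  cpos nu A = 0 /\ cneg nu A = 0.
Proof.
move=> mA v0; have /eqP : cpos nu A + cneg nu A = 0 := v0.
by rewrite padde_eq0// => /andP[/eqP ? /eqP].
Qed.

Lemma cintegrable_csupport nu D (f : T -> R) :
  measurable D -> csupport nu `<=` D -> measurable_fun D f ->
  cintegrable nu D f <-> cintegrable nu (csupport nu) f.
Proof.
move=> mD SD mf; have mS := csupport_measurable nu.
have mDS : measurable (D `\` csupport nu) by exact: measurableD.
have null : cvariation nu (D `\` csupport nu) = 0.
  apply/eqP; rewrite -measure_le0 -(csupportC_null nu).
  by apply: le_measure; rewrite ?inE//; exact: measurableC.
have mEf : measurable_fun D (EFin \o f) by exact/measurable_EFinP.
have := negligible_integrable mDS mD mEf null.
by rewrite setDD setIidr.
Qed.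

Lemma integral_csupport (mu : {finite_measure set T -> \bar R})
    (S D : set T) (f : T -> R) :
  measurable D -> measurable S -> S `<=` D -> mu (~` S) = 0 ->
  mu.-integrable D (EFin \o f) -> Rintegral mu S f = Rintegral mu D f.
Proof.
move=> mD mS SD S0 intf; congr fine.
rewrite [RHS](negligible_integral (N := D `\` S))//.
- by rewrite setDD setIidr.
- exact: measurableD.
apply/eqP; rewrite -measure_le0 -S0.
by apply: le_measure; rewrite ?inE;
  [exact: measurableD|exact: measurableC|exact: subIsetr].
Qed.

(** Different charges have different supports; this allows all the integrals
    to be taken over one common closed set. *)
Lemma cintegral_csupport nu D (f : T -> R) :
  measurable D -> csupport nu `<=` D -> cintegrable nu D f ->
  cintegral nu (csupport nu) f = cintegral nu D f.
Proof.
move=> mD SD intf.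
have mS := csupport_measurable nu.
have mSC : measurable (~` csupport nu) by exact: measurableC.
have S0 := csupportC_null nu.
have [i1 i2] := (integrable_charge_variation _ _ mD).1 intf.
by rewrite /cintegral !(integral_csupport mD mS SD)//;
  [exact: (jordan_null _ S0).2|exact: (jordan_null _ S0).1].
Qed.

End ChargeSupport.

(** * Densities of sums, multiples and products *)

Section DensityAlgebra.
Variable R : realType.
Local Notation T := (measurableTypeR R).
Local Open Scope classical_set_scope.
Local Open Scope ereal_scope.
Implicit Types (nu w : signed_measure R) (D : set T).
Variable m : {finite_measure set T -> \bar R}.

Lemma density_csum2 nu1 nu2 (g1 g2 : T -> R) :
  density m nu1 g1 -> density m nu2 g2 ->
  density m (csum2 nu1 nu2) (fun x => g1 x + g2 x)%R.
Proof.
move=> [i1 e1] [i2 e2]; split; first exact: (integrableD _ i1 i2).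
move=> A mA.
have S (g : T -> R) : m.-integrable setT (EFin \o g) ->
    m.-integrable A (EFin \o g).
  by move=> ig; apply: (integrableS measurableT).
rewrite (integralD_EFin mA (S _ i1) (S _ i2)) -e1// -e2//.
Qed.

Lemma density_csm a nu (g : T -> R) :
  density m nu g -> density m (csm a nu) (fun x => a * g x)%R.
Proof.
move=> [i e]; split; first exact: (integrableZl _ a i).
move=> A mA; have iA : m.-integrable A (EFin \o g).
  by apply: (integrableS measurableT).
rewrite (eq_integral (fun x => a%:E * (EFin \o g) x)); last first.
  by move=> x _; rewrite EFinM.
by rewrite (integralZl mA iA) -e.
Qed.

Lemma density_cnull : density m (@cnull R) (fun=> 0%R).
Proof.
split; first exact: integrable0.
by move=> A mA; rewrite integral0.
Qed.

Lemma density_big (I : Type) (r : seq I) (nu : I -> signed_measure R)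
    (g : I -> T -> R) :
  (forall i, density m (nu i) (g i)) ->
  density m (\big[@csum2 R/@cnull R]_(i <- r) nu i)
            (fun x => \sum_(i <- r) g i x)%R.
Proof.
move=> h; elim: r => [|a r IH].
  have -> : (fun x => \sum_(i <- [::]) g i x)%R = (fun=> 0%R).
    by apply/funext => x; rewrite big_nil.
  by rewrite big_nil; exact: density_cnull.
have -> : (fun x => \sum_(i <- a :: r) g i x)%R =
    (fun x => g a x + \sum_(i <- r) g i x)%R.
  by apply/funext => x; rewrite big_cons.
by rewrite big_cons; exact: density_csum2.
Qed.

(** Together with [density_csum2] and [density_csm] this gives the entries of a
    deformed measure matrix an explicit density. *)
Lemma density_cdensity c w (g : T -> R) :
  cintegrable w setT c -> density m w g ->
  density m (cdensity c w) (fun x => c x * g x)%R.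
Proof.
move=> ic gw.
have mc : measurable_fun setT (c : T -> R).
  by apply/measurable_EFinP; exact: measurable_int ic.
have [ip in_] := (integrable_charge_variation _ _ measurableT).1 ic.
have [icg _] := density_integral (svalP (hahn_sets w)) gw measurableT mc.
split; first exact/icg.
move=> A mA; rewrite /cdensity.
case: pselect => [fp|]; last by move=> /(_ ip).
case: pselect => [fn|]; last by move=> /(_ in_).
have mcA : measurable_fun A (c : T -> R) by exact: measurable_funTS.
have icA : cintegrable w A c by apply: (integrableS measurableT).
have [icgA E] := density_integral (svalP (hahn_sets w)) gw mA mcA.
have [ipA inA] := (integrable_charge_variation _ _ mA).1 icA.
rewrite -[RHS]fineK; last exact: (integrable_fin_num mA (icgA.1 icA)).
have -> : fine (\int[m]_(x in A) (c x * g x)%:E) =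
  Rintegral m A (fun x => c x * g x)%R by [].
rewrite -(E icA) EFinB /Rintegral !fineK; last 2 first.
- exact: (integrable_fin_num mA inA).
- exact: (integrable_fin_num mA ipA).
by rewrite -mulN1e.
Qed.

End DensityAlgebra.

(** * Functions dominated by polynomials, and integrals against combinations of charges *)

Section Moderate.
Variable R : realType.
Local Notation T := (measurableTypeR R).
Implicit Types (D : set T) (f g : T -> R).
Local Open Scope classical_set_scope.

(** Polynomial moments being finite, functions of this class are integrable
    against all the measures at hand; the class is closed under products, which
    mere integrability is not. *)
Definition moderate D f := measurable_fun D f /\
  exists p : {poly R}, forall x, D x -> `|f x| <= p.[x].

Lemma moderateM D f g :
  moderate D f -> moderate D g -> moderate D (fun x => f x * g x).
Proof.
move=> [mf [p fp]] [mg [r gr]]; split; first exact: measurable_funM.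
by exists (p * r) => x Dx; rewrite hornerM normrM ler_pM ?fp ?gr.
Qed.

Lemma moderateD D f g :
  moderate D f -> moderate D g -> moderate D (fun x => f x + g x).
Proof.
move=> [mf [p fp]] [mg [r gr]]; split; first exact: measurable_funD.
exists (p + r) => x Dx; rewrite hornerD (le_trans (ler_normD _ _))//.
by rewrite lerD ?fp ?gr.
Qed.

(** The absolute value of [p] is dominated by the polynomial [p ^ 2 + 1]. *)
Lemma moderate_horner D (p : {poly R}) : moderate D (horner p).
Proof.
split; first exact: measurable_poly.
exists (p ^+ 2 + 1) => x _; rewrite hornerD horner_exp hornerC.
rewrite -(normr_id p.[x]) -[p.[x] ^+ 2]real_normK ?num_real//.
rewrite normr_id; set t := `|_|; have t0 : 0 <= t by exact: normr_ge0.
by nra.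
Qed.

Lemma moderate_cst D a : moderate D (fun=> a).
Proof.
by have := moderate_horner D a%:P; congr moderate; apply/funext => x;
  rewrite hornerC.
Qed.

Lemma moderate_sum D (I : Type) (r : seq I) (f : I -> T -> R) :
  (forall i, moderate D (f i)) -> moderate D (fun x => \sum_(i <- r) f i x).
Proof.
move=> mf; elim: r => [|i r IH].
  by have := moderate_cst D 0; congr moderate; apply/funext => x; rewrite big_nil.
have := moderateD (mf i) IH; congr moderate; apply/funext => x.
by rewrite big_cons.
Qed.

Lemma moderateZ D a f : moderate D f -> moderate D (fun x => a * f x).
Proof. by apply: moderateM; exact: moderate_cst. Qed.

Lemma eq_moderate D f g : (forall x, D x -> f x = g x) ->
  moderate D f -> moderate D g.
Proof.
move=> fg [mf [p fp]]; split.
  by apply: eq_measurable_fun mf => x /set_mem; exact: fg.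
by exists p => x Dx; rewrite -fg// fp.
Qed.

End Moderate.

Section Combination.
Variable R : realType.
Local Notation T := (measurableTypeR R).
Implicit Types (D : set T).
Local Open Scope classical_set_scope.

Lemma jordan_cdirac (a : R) (A : set T) : measurable A ->
  cneg (cdirac a) A = 0%E /\ cpos (cdirac a) A = dirac (a : T) A.
Proof.
by move=> mA; apply: (@jordan_nonneg _ _ _ (cdirac a)) => //.
Qed.

(** A nonnegative charge has no negative Jordan part, whatever the chosen Hahn
    decomposition. *)
Lemma cintegral_cdirac (a : R) D (f : T -> R) : measurable D -> D a ->
  measurable_fun D f ->
  cintegrable (cdirac a) D f /\ cintegral (cdirac a) D f = f a.
Proof.
move=> mD Da mf; have mEf : measurable_fun D (EFin \o f) by exact/measurable_EFinP.
have pE (g : T -> \bar R) : measurable_fun D g ->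
    (\int[cpos (cdirac a)]_(x in D) g x = g a)%E.
  move=> mg; rewrite (eq_measure_integral (dirac (a : T))).
    by rewrite (integral_dirac _ mD mg) diracE mem_set// mul1e.
  by move=> A mA _; exact: (jordan_cdirac a mA).2.
have nE (g : T -> \bar R) : measurable_fun D g ->
    (\int[cneg (cdirac a)]_(x in D) g x = 0)%E.
  move=> mg; rewrite (eq_measure_integral mzero).
    by rewrite integral_measure_zero.
  by move=> A mA _; exact: (jordan_cdirac a mA).1.
split; last by rewrite /cintegral /Rintegral pE ?nE//= subr0.
apply/(integrable_charge_variation _ _ mD); split; apply/integrableP; split => //.
  by rewrite pE ?ltry//; exact: measurableT_comp.
by rewrite nE//; exact: measurableT_comp.
Qed.

Lemma csum2_big_null (I : Type) (r : seq I) (nu : I -> signed_measure R)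
    (A : set T) : (forall i, nu i A = 0%E) ->
  (\big[@csum2 R/@cnull R]_(i <- r) nu i) A = 0%E.
Proof.
move=> nu0; elim: r => [|i r IH]; first by rewrite big_nil.
rewrite big_cons; change (nu i A + (\big[@csum2 R/@cnull R]_(i <- r) nu i) A = 0)%E.
by rewrite nu0 IH adde0.
Qed.

Lemma cdensity_null (c : T -> R) (w : signed_measure R) (A : set T) :
  measurable A -> cvariation w A = 0%E -> cdensity c w A = 0%E.
Proof.
move=> mA w0; have [p0 n0] := jordan_null mA w0.
rewrite /cdensity; case: pselect => // fp; case: pselect => // fn.
change (\int[cpos w]_(x in A) (c x)%:E + (-1)%:E * \int[cneg w]_(x in A) (c x)%:E = 0)%E.
have mc : measurable_fun A (EFin \o c).
  by apply: measurable_funTS; exact: measurable_int fp.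
by rewrite !null_set_integral// mule0 adde0.
Qed.

Lemma Rintegral_sum (m : {measure set T -> \bar R}) D (I : Type) (r : seq I)
    (F : I -> T -> R) : measurable D ->
  (forall i, m.-integrable D (EFin \o F i)) ->
  m.-integrable D (EFin \o (fun x => \sum_(i <- r) F i x)) /\
  Rintegral m D (fun x => \sum_(i <- r) F i x) = \sum_(i <- r) Rintegral m D (F i).
Proof.
move=> mD iF; elim: r => [|i r [IHi IHE]].
  have -> : (fun x => \sum_(i <- [::]) F i x) = (fun=> 0).
    by apply/funext => x; rewrite big_nil.
  by split; [exact: integrable0|rewrite big_nil Rintegral_cst// mul0r].
have -> : (fun x => \sum_(j <- i :: r) F j x) =
    (fun x => F i x + \sum_(j <- r) F j x).
  by apply/funext => x; rewrite big_cons.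
split; first exact: (integrableD mD (iF i) IHi).
by rewrite RintegralD// big_cons IHE.
Qed.

Section Entry.
Variables (n s : nat) (w : 'I_n -> signed_measure R) (c : 'I_n -> T -> R).
Variables (a : 'I_s -> R) (q : 'I_s -> R) (D : set T).
Hypothesis clD : closed (D : set R).
Hypothesis wD : forall j, csupport (w j) `<=` D.
Hypothesis qD : forall i, D (q i).
Hypothesis wint : forall j f, moderate D f -> cintegrable (w j) D f.
Hypothesis cT : forall j, measurable_fun setT (c j).
Hypothesis cD : forall j, moderate D (c j).

Let nu := csum2 (\big[@csum2 R/@cnull R]_(j < n) cdensity (c j) (w j))
  (\big[@csum2 R/@cnull R]_(i < s) csm (a i) (cdirac (q i))).

Lemma csupport_entry : csupport nu `<=` D.
Proof.
apply: csupport_sub => // A mA AD.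
change ((\big[@csum2 R/@cnull R]_(j < n) cdensity (c j) (w j)) A +
  (\big[@csum2 R/@cnull R]_(i < s) csm (a i) (cdirac (q i))) A = 0)%E.
rewrite !csum2_big_null ?adde0// => i.
  change ((a i)%:E * \d_(q i : T) A = 0)%E.
  rewrite diracE memNset ?mule0// => /AD; apply; exact: qD.
apply: cdensity_null => //; apply/eqP; rewrite -measure_le0.
rewrite -(csupportC_null (w i)); apply: le_measure; rewrite ?inE//.
  by apply: measurableC; exact: csupport_measurable.
by apply: subset_trans AD _; apply: subsetC.
Qed.

(** An entry of a deformed measure matrix is a combination of densities and of
    point masses.  All its terms receive a density with respect to one measure
    [m], and the integral is computed there. *)
Lemma cintegral_entry (f : T -> R) : moderate D f ->
  cintegrable nu D f /\
  cintegral nu D f = \sum_(j < n) cintegral (w j) D (fun x => c j x * f x)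
    + \sum_(i < s) a i * f (q i).
Proof.
move=> mf; have [mfD _] := mf.
have mD : measurable D by exact: closed_measurable.
(* The charges [w j] and the point masses, listed as one sequence. *)
pose ch k : signed_measure R := match insub k with Some j => w j | None =>
  match insub (k - n)%N with Some i => cdirac (q i) | None => @cnull R end end.
have [m dom] := dominating_measure (n + s) ch.
have domw j : w j `<< m.
  by have := dom j (ltn_addr _ (ltn_ord j)); rewrite /ch valK.
have domq i : cdirac (q i) `<< m.
  have := dom (n + i)%N; rewrite ltn_add2l ltn_ord /ch => /(_ isT).
  by rewrite insubF ?addKn ?valK// ltnNge leq_addr.
have /choice[g gw] j : exists g, density m (w j) g by exact: density_exists.
have /choice[d dq] i : exists g, density m (cdirac (q i)) g.
  exact: density_exists.
have cint j : cintegrable (w j) setT (c j).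
  have S := csupport_measurable (w j).
  apply/(cintegrable_csupport measurableT (@subsetT _ _) (cT j)).
  by apply: (integrableS mD S (@wD j)); exact: wint.
have dens := density_csum2
  (density_big (index_enum 'I_n) (fun j => density_cdensity (cint j) (gw j)))
  (density_big (index_enum 'I_s) (fun i => density_csm (a i) (dq i))).
have mcf j : moderate D (fun x => c j x * f x) by exact: moderateM.
have iw j : m.-integrable D (EFin \o (fun x => c j x * f x * g j x)).
  have [mcfD _] := mcf j.
  apply: (density_integral (svalP (hahn_sets (w j))) (gw j) mD mcfD).1.1.
  exact: wint.
have iq i : m.-integrable D (EFin \o (fun x => f x * d i x)).
  apply: (density_integral (svalP (hahn_sets _)) (dq i) mD mfD).1.1.
  exact: (cintegral_cdirac mD (qD i) mfD).1.
pose F1 j x := c j x * f x * g j x; pose F2 i x := a i * (f x * d i x).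
have FE : (fun x => f x * (\sum_(j < n) c j x * g j x + \sum_(i < s) a i * d i x)) =
    (fun x => \sum_(j < n) F1 j x + \sum_(i < s) F2 i x).
  apply/funext => x; rewrite mulrDr !mulr_sumr; congr (_ + _);
    apply: eq_bigr => i _; rewrite /F1 /F2; ring.
have iq' i : m.-integrable D (EFin \o F2 i).
  exact: (integrableZl mD (a i) (iq i)).
have [i1 E1] := Rintegral_sum (index_enum 'I_n) mD iw.
have [i2 E2] := Rintegral_sum (index_enum 'I_s) mD iq'.
have [iff E] := density_integral (svalP (hahn_sets nu)) dens mD mfD.
have inu : cintegrable nu D f.
  by apply/iff; rewrite FE; exact: (integrableD mD i1 i2).
split => //; rewrite [LHS](E inu) FE RintegralD// E1 E2.
congr (_ + _); apply: eq_bigr => i _.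
  have [mcfD _] := mcf i.
  by rewrite -((density_integral (svalP (hahn_sets (w i))) (gw i) mD mcfD).2 _)//;
    exact: wint.
rewrite RintegralZl//; congr (_ * _).
rewrite -((density_integral (svalP (hahn_sets _)) (dq i) mD mfD).2 _).
  exact: (cintegral_cdirac mD (qD i) mfD).2.
exact: (cintegral_cdirac mD (qD i) mfD).1.
Qed.

End Entry.
End Combination.

(** * Inverses of lower triangular semi-infinite matrices *)

Section LowerTriangular.
Variable R : fieldType.
Implicit Types (A B C S : smx R).

Definition lower_triangular A := forall i j, (i < j)%N -> A i j = 0.

Section Inverse.
Variable A : smx R.
Hypotheses (lA : lower_triangular A) (dA : forall i, A i i != 0).

Lemma trunc_unitmx k : trunc k A \in unitmx.
Proof.
rewrite unitmxE det_trig; last first.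
  by apply/is_trig_mxP => i j ij; rewrite mxE lA.
by rewrite unitfE; apply/prodf_neq0 => i _; rewrite mxE.
Qed.

(** Column [j] of the inverse is found by descending induction: once the
    entries to the right of [j] vanish, the product with [A] leaves only the
    diagonal term. *)
Lemma invmx_trunc_lower k (i j : 'I_k) : (i < j)%N ->
  invmx (trunc k A) i j = 0.
Proof.
have [n] := ubnP (k - j)%N; elim: n j => // n IH j; rewrite ltnS => jn ij.
have : (invmx (trunc k A) *m trunc k A) i j = 0.
  by rewrite mulVmx ?trunc_unitmx// mxE -val_eqE /= ltn_eqF.
rewrite mxE (bigD1 j)//= big1 ?addr0 => [|l lj].
  by rewrite mxE => /eqP; rewrite mulf_eq0 (negPf (dA _)) orbF => /eqP.
have [jl|lj'|/val_inj jl] := ltngtP j l.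
- rewrite IH ?mul0r//; last exact: ltn_trans jl.
  by apply: leq_trans jn; rewrite ltn_sub2l.
- by rewrite [trunc k A l j]mxE lA ?mulr0.
- by rewrite jl eqxx in lj.
Qed.

(** The leading block of the inverse of a larger truncation is a left inverse of
    the smaller truncation, the discarded terms being above the diagonal. *)
Lemma tri_invE k (i j : 'I_k) : tri_inv A i j = invmx (trunc k A) i j.
Proof.
rewrite /tri_inv; set K := (maxn i j).+1.
have Kk : (K <= k)%N by rewrite gtn_max !ltn_ord.
have iK : (i < K)%N by rewrite ltnS leq_maxl.
have jK : (j < K)%N by rewrite ltnS leq_maxr.
pose w := widen_ord Kk.
have -> : invmx (trunc K A) = \matrix_(a, b) invmx (trunc k A) (w a) (w b).
  set X := \matrix_(_, _) _.
  have XA : X *m trunc K A = 1%:M.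
    apply/matrixP => a b; rewrite mxE [RHS]mxE.
    have -> : (a == b) = (w a == w b) by rewrite -!val_eqE.
    have := mulVmx (trunc_unitmx k) => /matrixP/(_ (w a) (w b)).
    rewrite mxE [RHS]mxE => <-.
    rewrite [RHS](bigID (fun l : 'I_k => (l < K)%N)) /= [X in _ + X]big1 ?addr0.
      rewrite (big_ord_narrow Kk) /=.
      by apply: eq_bigr => l _; rewrite !mxE.
    move=> l; rewrite -leqNgt => Kl; rewrite invmx_trunc_lower ?mul0r//.
    exact: leq_trans (ltn_ord a) Kl.
  by rewrite -[RHS]mulmx1 -(mulmxV (trunc_unitmx K)) mulmxA XA mul1mx.
by rewrite mxE; congr (invmx _ _ _); apply: val_inj; rewrite /= inordK.
Qed.

Lemma tri_inv_lower : lower_triangular (tri_inv A).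
Proof.
move=> i j ij; have jk : (j < j.+1)%N by [].
have ik : (i < j.+1)%N by exact: ltn_trans jk.
by have := @invmx_trunc_lower _ (Ordinal ik) (Ordinal jk) ij; rewrite -tri_invE.
Qed.

Lemma lmul_tri_invl i j : lmul (tri_inv A) A i j = (i == j)%:R.
Proof.
pose k := (maxn i j).+1.
have ik : (i < k)%N by rewrite ltnS leq_maxl.
have jk : (j < k)%N by rewrite ltnS leq_maxr.
have := mulVmx (trunc_unitmx k) => /matrixP/(_ (Ordinal ik) (Ordinal jk)).
rewrite mxE [RHS]mxE -val_eqE /= => <-.
rewrite /lmul [RHS](bigID (fun l : 'I_k => (l < i.+1)%N)) /= [X in _ + X]big1.
  rewrite addr0 (big_ord_narrow ik) /=.
  by apply: eq_bigr => l _; rewrite mxE -tri_invE.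
by move=> l; rewrite -leqNgt => il; rewrite invmx_trunc_lower ?mul0r.
Qed.

Lemma lmul_tri_invr i j : lmul A (tri_inv A) i j = (i == j)%:R.
Proof.
pose k := (maxn i j).+1.
have ik : (i < k)%N by rewrite ltnS leq_maxl.
have jk : (j < k)%N by rewrite ltnS leq_maxr.
have := mulmxV (trunc_unitmx k) => /matrixP/(_ (Ordinal ik) (Ordinal jk)).
rewrite mxE [RHS]mxE -val_eqE /= => <-.
rewrite /lmul [RHS](bigID (fun l : 'I_k => (l < i.+1)%N)) /= [X in _ + X]big1.
  rewrite addr0 (big_ord_narrow ik) /=.
  by apply: eq_bigr => l _; rewrite mxE -tri_invE.
by move=> l; rewrite -leqNgt => il; rewrite mxE lA ?mul0r.
Qed.

End Inverse.

Lemma lmul_lower A B : lower_triangular A -> lower_triangular B ->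
  lower_triangular (lmul A B).
Proof.
move=> lA lB i j ij; rewrite /lmul big1 // => k _.
by rewrite (lB k j) ?mulr0// (leq_ltn_trans _ ij)// -ltnS ltn_ord.
Qed.

Lemma lmul_widen A B n i j : lower_triangular A -> (i < n)%N ->
  lmul A B i j = \sum_(k < n) A i k * B k j.
Proof.
move=> lA ik; rewrite [RHS](bigID (fun l : 'I_n => (l < i.+1)%N)) /=.
rewrite [X in _ + X]big1 ?addr0; first by rewrite (big_ord_narrow ik).
by move=> l; rewrite -leqNgt => il; rewrite lA ?mul0r.
Qed.

Lemma lmulA A B C : lower_triangular A -> lower_triangular B ->
  lmul (lmul A B) C =2 lmul A (lmul B C).
Proof.
move=> lA lB i j; rewrite /lmul.
under eq_bigr do rewrite mulr_suml.
rewrite exchange_big /=; apply: eq_bigr => k _.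
rewrite -/(lmul B C k j) (@lmul_widen B C i.+1)//.
by rewrite mulr_sumr; apply: eq_bigr => l _; rewrite mulrA.
Qed.

Lemma eq_lmul A A' B B' : A =2 A' -> B =2 B' -> lmul A B =2 lmul A' B'.
Proof. by move=> e f i j; apply: eq_bigr => k _; rewrite e f. Qed.

Lemma lmul1 B (A : smx R) : (forall i j, A i j = (i == j)%:R) -> lmul A B =2 B.
Proof.
move=> A1 i j; rewrite /lmul big_ord_recr /= A1 eqxx mul1r big1 ?add0r// => k _.
by rewrite A1 gtn_eqF ?mul0r.
Qed.

Lemma lmulr1 A B : lower_triangular A -> (forall i j, B i j = (i == j)%:R) ->
  lmul A B =2 A.
Proof.
move=> lA B1 i j; rewrite (@lmul_widen _ _ (maxn i j).+1) ?ltnS ?leq_maxl//.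
have jm : (j < (maxn i j).+1)%N by rewrite ltnS leq_maxr.
rewrite (bigD1 (Ordinal jm))//= B1 eqxx mulr1 big1 ?addr0// => k kj.
by move: kj; rewrite -val_eqE /= => /negPf kj; rewrite B1 kj mulr0.
Qed.

Lemma lmul_sdiag (h : nat -> R) B i j : lmul (sdiag h) B i j = h i * B i j.
Proof.
rewrite /lmul big_ord_recr /= /sdiag eqxx big1 ?add0r// => k _.
by rewrite gtn_eqF ?mul0r.
Qed.

End LowerTriangular.

(** * LU factorization and biorthogonality *)

Section BilinearForm.
Variable R : fieldType.
Implicit Types (G S : smx R) (p r : {poly R}).

(** The bilinear form on polynomials whose Gram matrix on monomials is [G]. *)
Definition form G p r := \sum_(i < size p) \sum_(j < size r) p`_i * r`_j * G i j.

Lemma formE G n m p r : (size p <= n)%N -> (size r <= m)%N ->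
  form G p r = \sum_(i < n) \sum_(j < m) p`_i * r`_j * G i j.
Proof.
move=> pn rm; rewrite /form.
rewrite (big_ord_widen n (fun i => \sum_(j < size r) p`_i * r`_j * G i j))//.
rewrite big_mkcond /=; apply: eq_bigr => i _; case: ltnP => ip; last first.
  by rewrite big1// => j _; rewrite nth_default// !mul0r.
rewrite (big_ord_widen m (fun j => p`_i * r`_j * G i j))// big_mkcond /=.
apply: eq_bigr => j _; case: ltnP => // jr.
by rewrite [r`_j]nth_default// mulr0 mul0r.
Qed.

Lemma formDl G p1 p2 r : form G (p1 + p2) r = form G p1 r + form G p2 r.
Proof.
rewrite !(@formE G (maxn (size p1) (size p2)) (size r)) ?leq_maxl ?leq_maxr//.
  rewrite -big_split; apply: eq_bigr => i _; rewrite -big_split.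
  by apply: eq_bigr => j _; rewrite coefD !mulrDl.
exact: size_polyD.
Qed.

Lemma formDr G p r1 r2 : form G p (r1 + r2) = form G p r1 + form G p r2.
Proof.
rewrite !(@formE G (size p) (maxn (size r1) (size r2))) ?leq_maxl ?leq_maxr//.
  rewrite -big_split; apply: eq_bigr => i _; rewrite -big_split.
  by apply: eq_bigr => j _; rewrite coefD mulrDr mulrDl.
exact: size_polyD.
Qed.

Lemma formZl G a p r : form G (a *: p) r = a * form G p r.
Proof.
rewrite !(@formE G (size p) (size r)) ?size_scale_leq// mulr_sumr.
apply: eq_bigr => i _; rewrite mulr_sumr; apply: eq_bigr => j _.
by rewrite coefZ !mulrA.
Qed.

Lemma formZr G a p r : form G p (a *: r) = a * form G p r.
Proof.
rewrite !(@formE G (size p) (size r)) ?size_scale_leq// mulr_sumr.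
apply: eq_bigr => i _; rewrite mulr_sumr; apply: eq_bigr => j _.
by rewrite coefZ; ring.
Qed.

Lemma form0l G r : form G 0 r = 0.
Proof. by rewrite /form size_poly0 big_ord0. Qed.

Lemma form0r G p : form G p 0 = 0.
Proof. by rewrite /form big1 // => i _; rewrite size_poly0 big_ord0. Qed.

Lemma form_suml G (I : Type) (s : seq I) (p : I -> {poly R}) r :
  form G (\sum_(i <- s) p i) r = \sum_(i <- s) form G (p i) r.
Proof. by apply: (big_morph (form G ^~ r)) => [? ?|]; rewrite ?formDl ?form0l. Qed.

Lemma form_sumr G (I : Type) (s : seq I) p (r : I -> {poly R}) :
  form G p (\sum_(i <- s) r i) = \sum_(i <- s) form G p (r i).
Proof. by apply: (big_morph (form G p)) => [? ?|]; rewrite ?formDr ?form0r. Qed.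

Lemma coef_biorth S l a : lower_unitriangular S -> (biorth_poly S l)`_a = S l a.
Proof.
move=> [_ lS]; rewrite coef_poly ltnS; case: leqP => // la.
by rewrite lS.
Qed.

Lemma size_biorth S l : (size (biorth_poly S l) <= l.+1)%N.
Proof. exact: size_poly. Qed.

Lemma unitriangular_neq0 S i : lower_unitriangular S -> S i i != 0.
Proof. by move=> [-> _]; exact: oner_neq0. Qed.

Section LU.
Variables (G : smx R) (F : LU_data R).
Hypothesis GF : is_LU G F.
Local Notation p1 := (biorth_poly (lu_S1 F)).
Local Notation p2 := (biorth_poly (lu_S2 F)).
Local Notation h := (lu_h F).

Lemma LU_S1 : lower_unitriangular (lu_S1 F). Proof. by case: GF. Qed.
Lemma LU_S2 : lower_unitriangular (lu_S2 F). Proof. by case: GF. Qed.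

Lemma tri_inv_S1l i j :
  lmul (tri_inv (lu_S1 F)) (lu_S1 F) i j = (i == j)%:R.
Proof.
apply: lmul_tri_invl; first by case: LU_S1.
by move=> l; exact: (unitriangular_neq0 _ LU_S1).
Qed.

Lemma lower_tri_inv_S1 : lower_triangular (tri_inv (lu_S1 F)).
Proof.
apply: tri_inv_lower; first by case: LU_S1.
by move=> l; exact: (unitriangular_neq0 _ LU_S1).
Qed.

(** Multiplying the factorization by the two unitriangular factors leaves the
    diagonal one. *)
Lemma LU_biorthogonal i j : form G (p1 i) (p2 j) = if i == j then h i else 0.
Proof.
have [S1d S1l] := LU_S1; have [S2d S2l] := LU_S2; case: GF => _ _ GE.
have S1n l : lu_S1 F l l != 0 := unitriangular_neq0 l LU_S1.
have S2n l : lu_S2 F l l != 0 := unitriangular_neq0 l LU_S2.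
have S1G a b : lmul (lu_S1 F) G a b = h a * tri_inv (lu_S2 F) b a.
  rewrite (eq_lmul (fun _ _ => erefl) GE) -lmulA//; last exact: lower_tri_inv_S1.
  by rewrite lmul1 ?lmul_sdiag// => c d; exact: lmul_tri_invr.
rewrite (@formE G i.+1 j.+1) ?size_biorth// exchange_big /=.
under eq_bigr => b _.
  under eq_bigr => a _ do
    rewrite (coef_biorth _ _ LU_S1) (coef_biorth _ _ LU_S2) mulrAC.
  rewrite -mulr_suml -/(lmul (lu_S1 F) G i b) S1G mulrAC -mulrA.
  over.
rewrite -mulr_sumr -/(lmul (lu_S2 F) (tri_inv (lu_S2 F)) j i).
rewrite lmul_tri_invr// eq_sym; case: eqP => _; rewrite ?mulr1 ?mulr0//.
Qed.

Lemma trunc_lmul k (A B : smx R) : lower_triangular A ->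
  trunc k (lmul A B) = trunc k A *m trunc k B.
Proof.
move=> lA; apply/matrixP => i j; rewrite !mxE (lmul_widen _ _ lA (ltn_ord i)).
by apply: eq_bigr => l _; rewrite !mxE.
Qed.

Lemma LU_h_neq0 : LU_factorizable G -> forall i, h i != 0.
Proof.
move=> Gd i; have := Gd i.+1 isT; case: GF => _ _ GE.
have -> : trunc i.+1 G = trunc i.+1 (lmul (tri_inv (lu_S1 F))
    (lmul (sdiag h) (strmx (tri_inv (lu_S2 F))))).
  by apply/matrixP => a b; rewrite !mxE GE.
have ld : lower_triangular (sdiag h) by move=> a b ab; rewrite /sdiag ltn_eqF.
rewrite !trunc_lmul//; last exact: lower_tri_inv_S1.
rewrite !det_mulmx !mulf_eq0 !negb_or => /and3P[_ + _].
rewrite det_trig; last by apply/is_trig_mxP => a b ab; rewrite mxE ld.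
by move/prodf_neq0/(_ ord_max isT); rewrite mxE /sdiag eqxx.
Qed.

Lemma biorth_span S n p : lower_unitriangular S -> (size p <= n)%N ->
  exists c : nat -> R, p = \sum_(a < n) c a *: biorth_poly S a.
Proof.
move=> uS; elim: n p => [p|n IH p pn].
  by rewrite leqn0 size_poly_eq0 => /eqP ->; exists (fun=> 0); rewrite big_ord0.
have [c pE] : exists c : nat -> R,
    p - p`_n *: biorth_poly S n = \sum_(a < n) c a *: biorth_poly S a.
  apply: IH; apply/leq_sizeP => j; rewrite leq_eqVlt => /predU1P[<-|nj].
    by rewrite coefB coefZ coef_biorth//; case: uS => -> _; rewrite mulr1 subrr.
  rewrite coefB coefZ coef_biorth//; case: uS => _ ->//.
  by rewrite mulr0 subr0 nth_default// (leq_trans pn).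
exists (fun a => if a == n then p`_n else c a).
rewrite big_ord_recr /= eqxx -[LHS](subrK (p`_n *: biorth_poly S n)) pE.
by congr (_ + _); apply: eq_bigr => a _; rewrite ltn_eqF.
Qed.

Hypothesis h0 : forall i, h i != 0.

(** Biorthogonality identifies the coefficients of an expansion whose existence
    only uses that the family has one monic polynomial in each degree. *)
Lemma biorth_expansion n p : (size p <= n)%N ->
  p = \sum_(a < n) (form G (p1 a) p / h a) *: p2 a.
Proof.
move=> /(biorth_span LU_S2)[c pE]; rewrite {1}pE; apply: eq_bigr => a _.
congr (_ *: _); rewrite pE form_sumr (bigD1 a)//= big1 ?addr0 => [|b ba].
  by rewrite formZr LU_biorthogonal eqxx mulfK.
move: ba; rewrite -val_eqE eq_sym /= => /negPf ba.
by rewrite formZr LU_biorthogonal ba mulr0.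
Qed.

Lemma biorth_orth a p : (size p <= a)%N -> form G (p1 a) p = 0.
Proof.
move=> /biorth_expansion ->; rewrite form_sumr big1// => b _.
by rewrite formZr LU_biorthogonal gtn_eqF ?mulr0.
Qed.

End LU.
End BilinearForm.

(** * Resolvent of a deformation, and the kernel identity *)

Section Deformation.
Variables (R : fieldType) (G Gc : smx R) (F Fc : LU_data R).
Variables (Q : {poly R}) (N : nat).
Hypotheses (GF : is_LU G F) (GcFc : is_LU Gc Fc).
Hypotheses (h0 : forall i, lu_h F i != 0) (hc0 : forall i, lu_h Fc i != 0).
Hypothesis sQ : (size Q <= N.+1)%N.
Hypothesis GQ : forall p r, form G p r = form Gc p (Q * r).

Local Notation p1 := (biorth_poly (lu_S1 F)).
Local Notation p2 := (biorth_poly (lu_S2 F)).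
Local Notation q1 := (biorth_poly (lu_S1 Fc)).
Local Notation q2 := (biorth_poly (lu_S2 Fc)).
Local Notation omega := (lmul (lu_S1 Fc) (tri_inv (lu_S1 F))).

Lemma omega_lower : lower_triangular omega.
Proof.
apply: lmul_lower; last exact: (lower_tri_inv_S1 GF).
by case: (LU_S1 GcFc).
Qed.

Lemma omega_poly a : q1 a = \sum_(b < a.+1) omega a b *: p1 b.
Proof.
have [_ Sl] := LU_S1 GcFc.
apply/polyP => j; rewrite coef_biorth; last exact: LU_S1 GcFc.
rewrite coef_sum; under eq_bigr => b _.
  rewrite coefZ coef_biorth; last exact: LU_S1 GF.
  over.
rewrite -/(lmul omega (lu_S1 F) a j) lmulA//; last exact: (lower_tri_inv_S1 GF).
by rewrite lmulr1//; exact: (tri_inv_S1l GF).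
Qed.

(** The resolvent is the matrix of multiplication by [Q] from one family to the
    other, up to the normalizations; this links it to [Q p_j] and not only to
    the change of basis [omega_poly]. *)
Lemma omega_form a j : form Gc (q1 a) (Q * p2 j) = omega a j * lu_h F j.
Proof.
rewrite -GQ omega_poly form_suml.
have E (b : 'I_a.+1) : form G (omega a b *: p1 b) (p2 j) =
    if b == j :> nat then omega a b * lu_h F b else 0.
  by rewrite formZl (LU_biorthogonal GF); case: ifP; rewrite ?mulr0.
under eq_bigr do rewrite E.
case: (ltnP j a.+1) => ja; last first.
  rewrite omega_lower// mul0r big1// => b _; rewrite ltn_eqF//.
  exact: leq_trans (ltn_ord b) ja.
rewrite (bigD1 (Ordinal ja))//= eqxx big1 ?addr0// => b bj.
by move: bj; rewrite -val_eqE /= => /negPf ->.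
Qed.

Lemma size_Qp2 j : (size (Q * p2 j)%R <= j + N.+1)%N.
Proof.
have := size_polyMleq Q (p2 j); have := size_biorth (lu_S2 F) j.
by move: sQ; lia.
Qed.

(** [Q p_j] has degree at most [j + N], hence is orthogonal to the deformed
    polynomials of higher index. *)
Lemma omega_banded a b : (b + N < a)%N -> omega a b = 0.
Proof.
move=> ba; apply: (mulIf (h0 b)); rewrite mul0r -omega_form.
by apply: (biorth_orth GcFc hc0); apply: leq_trans (size_Qp2 _) _; rewrite addnS.
Qed.

Lemma Qp2_expansion k j : (j < k)%N ->
  (lu_h F j)^-1 *: (Q * p2 j) =
    \sum_(a < k + N) (omega a j / lu_h Fc a) *: q2 a.
Proof.
move=> jk; have sz : (size (Q * p2 j)%R <= k + N)%N.
  by apply: leq_trans (size_Qp2 _) _; rewrite addnS -addSn leq_add2r.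
rewrite [X in _ *: X](biorth_expansion GcFc hc0 sz) scaler_sumr.
apply: eq_bigr => a _; rewrite scalerA omega_form; congr (_ *: _).
by rewrite mulrC mulrAC mulfK.
Qed.

Variables (C : comNzRingType) (f : {rmorphism R -> C}) (x : C).
Local Notation ev p := ((map_poly f p).[x]).

Lemma ev_sum n (c : nat -> R) (p : nat -> {poly R}) :
  ev (\sum_(a < n) c a *: p a) = \sum_(a < n) f (c a) * ev (p a).
Proof.
rewrite rmorph_sum horner_sum; apply: eq_bigr => a _.
by rewrite /= map_polyZ hornerZ.
Qed.

(** The sequence [v] is arbitrary: the identity is applied both to values of
    polynomials and to second kind functions. *)
Lemma deformed_kernel k (v : nat -> C) :
  \sum_(a < k) ev (q2 a) * f (lu_h Fc a)^-1 * (\sum_(b < a.+1) f (omega a b) * v b)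
  = ev Q * (\sum_(j < k) ev (p2 j) * f (lu_h F j)^-1 * v j)
    - \sum_(i < N) ev (q2 (k + i)%N) * f (lu_h Fc (k + i)%N)^-1 *
        (\sum_(j < k) f (omega (k + i)%N j) * v j).
Proof.
apply/eqP; rewrite eq_sym subr_eq; apply/eqP.
have -> : ev Q * (\sum_(j < k) ev (p2 j) * f (lu_h F j)^-1 * v j) =
  \sum_(a < k + N) ev (q2 a) * f (lu_h Fc a)^-1 * \sum_(j < k) f (omega a j) * v j.
  rewrite mulr_sumr; under [RHS]eq_bigr do rewrite mulr_sumr.
  rewrite [RHS]exchange_big /=; apply: eq_bigr => j _.
  have -> : ev Q * (ev (p2 j) * f (lu_h F j)^-1 * v j) =
      ev ((lu_h F j)^-1 *: (Q * p2 j)) * v j.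
    by rewrite /= map_polyZ hornerZ rmorphM hornerM /=; ring.
  rewrite (Qp2_expansion (ltn_ord j)).
  rewrite (ev_sum _ (fun a => omega a j / lu_h Fc a)) mulr_suml.
  by apply: eq_bigr => a _; rewrite rmorphM /=; ring.
(* For [a < k], the sum over [j < k] stops at the diagonal. *)
rewrite big_split_ord /=; congr (_ + _); apply: eq_bigr => a _.
congr (_ * _).
rewrite [LHS](bigID (fun j : 'I_k => (j < a.+1)%N)) /= [X in _ + X]big1.
  by rewrite addr0 (big_ord_narrow (ltn_ord a)).
by move=> j; rewrite -leqNgt => aj; rewrite omega_lower// rmorph0 mul0r.
Qed.

End Deformation.

Section Sandwich.
Variable R : realType.

(** Counting down from [k - 1], both sums run over the same indices, except for
    those where one of the two sides extends by zero. *)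
Lemma sum_zext (V : nmodType) (g : nat -> V) (k N : nat) :
  (forall b, (b + N < k)%N -> g b = 0) ->
  \sum_(j < N) zext g (k%:Z - N%:Z + j%:Z) = \sum_(b < k) g b.
Proof.
move=> g0; rewrite (reindex_inj rev_ord_inj) [RHS](reindex_inj rev_ord_inj) /=.
have -> : \sum_(j < N) zext g (k%:Z - N%:Z + (N - j.+1)%N%:Z) =
    \sum_(j < N) if (j < k)%N then g (k - j.+1)%N else 0.
  apply: eq_bigr => j _; have jN := ltn_ord j; case: ltnP => jk.
    have -> : k%:Z - N%:Z + (N - j.+1)%N%:Z = (k - j.+1)%N%:Z by lia.
    by [].
  have -> : k%:Z - N%:Z + (N - j.+1)%N%:Z = Negz (j - k) by rewrite NegzE; lia.
  by [].
have -> : \sum_(j < k) g (k - j.+1)%N =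
    \sum_(j < k) if (j < N)%N then g (k - j.+1)%N else 0.
  by apply: eq_bigr => j _; case: ltnP => // Nj; rewrite g0//; have := ltn_ord j; lia.
rewrite -!big_mkcond /=; case: (leqP N k) => [Nk|/ltnW kN].
  rewrite [RHS](big_ord_narrow Nk) big_mkcond; apply: eq_bigr => j _.
  by rewrite (leq_trans (ltn_ord j)).
rewrite [LHS](big_ord_narrow kN) [RHS]big_mkcond; apply: eq_bigr => j _.
by rewrite (leq_trans (ltn_ord j)).
Qed.

(** Since [w] is banded, the [N] columns kept in [Gamma] account for all the
    indices [j < k]. *)
Lemma sandwichE N k (u v : nat -> R[i]) (h : nat -> R) (w : smx R) :
  (forall a b, (b + N < a)%N -> w a b = 0) ->
  sandwich k u (Gamma h w N k) v =
  \sum_(i < N) u (k + i)%N * ((h (k + i)%N)^-1)%:C *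
    \sum_(j < k) (w (k + i)%N j)%:C * v j.
Proof.
move=> w0; rewrite /sandwich /Gamma mul_diag_mx -mulmxA mxE; apply: eq_bigr => i _.
rewrite mxE -mulrA; congr (_ * _).
rewrite -(@sum_zext _ (fun j => (w (k + i)%N j)%:C * v j) k N); last first.
  by move=> b bk; rewrite w0 ?mul0r// (leq_trans bk)// leq_addr.
rewrite mulr_sumr mxE; apply: eq_bigr => j _.
rewrite !mxE rmorphM /= -mulrA; congr (_ * _).
by case: (_ + _) => b /=; rewrite ?mul0r.
Qed.

End Sandwich.

(** * The Leibniz rule and the matrices Q(X) *)

Section Leibniz.
Variable R : comNzRingType.
Implicit Types p r : {poly R}.

Lemma derivn_mul p r n :
  (p * r)^`(n) = \sum_(l < n.+1) (p^`(n - l) * r^`(l)) *+ 'C(n, l).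
Proof.
elim: n => [|n IH]; first by rewrite big_ord1 subnn !derivn0 bin0.
rewrite derivnS IH raddf_sum /=.
have E (l : 'I_n.+1) : (p^`(n - l) * r^`(l) *+ 'C(n, l))^`() =
    p^`(n.+1 - l) * r^`(l) *+ 'C(n, l) + p^`(n - l) * r^`(l.+1) *+ 'C(n, l).
  by rewrite derivMn derivM -!derivnS mulrnDl subSn// -ltnS.
under eq_bigr do rewrite E.
rewrite big_split /= big_ord_recl [X in _ + X]big_ord_recr /=.
rewrite [RHS]big_ord_recl [in RHS]big_ord_recr /=. rewrite ?bin0 ?subn0 ?subnn ?binn.
rewrite -!addrA; congr (_ + _); rewrite addrA; congr (_ + _).
rewrite -big_split /=; apply: eq_bigr => l _.
by rewrite /bump /= !add1n subSS -mulrnDr; congr (_ *+ _); rewrite binS.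
Qed.

End Leibniz.

Section TriangularTranspose.
Variable R : fieldType.

Lemma trmx_horner_mx n (A : 'M[R]_n.+1) (p : {poly R}) :
  horner_mx A^T p = (horner_mx A p)^T.
Proof.
elim/poly_ind: p => [|p c IH]; first by rewrite !rmorph0 trmx0.
rewrite !rmorphD !rmorphM /= !horner_mx_X !horner_mx_C IH linearD /= tr_scalar_mx.
congr (_ + _); rewrite -!mulmxE -trmx_mul; congr (_^T).
exact/esym/comm_horner_mx.
Qed.

Lemma trunc_strmx k (A : smx R) : trunc k (strmx A) = (trunc k A)^T.
Proof. by apply/matrixP => i j; rewrite !mxE. Qed.

Lemma tri_horner_strmx (Q : {poly R}) (A : smx R) i j :
  tri_horner Q (strmx A) i j = tri_horner Q A j i.
Proof. by rewrite /tri_horner maxnC trunc_strmx trmx_horner_mx mxE. Qed.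

Lemma tri_inv_strmx (A : smx R) i j : tri_inv (strmx A) i j = tri_inv A j i.
Proof. by rewrite /tri_inv maxnC trunc_strmx -trmx_inv mxE. Qed.

Lemma eq_tri_inv (A B : smx R) : A =2 B -> tri_inv A =2 tri_inv B.
Proof.
move=> AB i j; rewrite /tri_inv; congr (invmx _ _ _).
by apply/matrixP => a b; rewrite !mxE AB.
Qed.

(** Polynomial entries of the transpose of [Q(X)], in closed form. *)
Definition deriv_mx (Q : {poly R}) : nat -> nat -> {poly R} :=
  fun r l => if (l <= r)%N then Q^`(r - l) *+ 'C(r, l) else 0.

Lemma tri_horner_calXT (Q : {poly R}) x r l :
  tri_horner Q (strmx (calX x)) r l = (deriv_mx Q r l).[x].
Proof.
rewrite tri_horner_strmx tri_horner_calX /deriv_mx; case: ifP => lr.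
  by rewrite hornerMn bin_sub.
by rewrite horner0.
Qed.

(** Cramer's rule, applied to a matrix of polynomials in [x] whose determinant
    is a power of [Q].  At the roots of [Q] the matrix is not invertible and is its own
    conventional inverse. *)
Lemma tri_inv_rational (Q : {poly R}) j r : exists (p1 p2 : {poly R}) K,
  forall x, tri_inv (tri_horner Q (strmx (calX x))) j r =
    if Q.[x] == 0 then p1.[x] else p2.[x] / Q.[x] ^+ K.
Proof.
pose K := (maxn j r).+1; pose M := trunc K (deriv_mx Q).
exists (deriv_mx Q j r), ((\adj M) (inord j) (inord r)), K => x.
have AM : trunc K (tri_horner Q (strmx (calX x))) = map_mx (horner_eval x) M.
  by apply/matrixP => a b; rewrite !mxE tri_horner_calXT.
have detM : \det (map_mx (horner_eval x) M) = Q.[x] ^+ K.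
  rewrite det_trig; last first.
    apply/is_trig_mxP => a b ab.
    by rewrite !mxE /deriv_mx leqNgt ab /= /horner_eval horner0.
  transitivity (\prod_(a < K) Q.[x]); last by rewrite prodr_const card_ord.
  apply: eq_bigr => a _.
  by rewrite !mxE /deriv_mx leqnn subnn derivn0 binn.
rewrite /tri_inv -/K AM; case: eqP => [Q0|/eqP Q0].
  rewrite invmx_out; last by rewrite inE unitmxE detM Q0 expr0n unitr0.
  by rewrite !mxE /horner_eval !inordK// ltnS ?leq_maxl ?leq_maxr.
rewrite /invmx unitmxE detM unitfE expf_neq0// mxE -map_mx_adj !mxE mulrC.
by [].
Qed.

(** By the Leibniz rule the inner sums are the derivatives of the product of [Q]
    with the function whose derivatives are [H]; the inverse matrix recovers
    the latter. *)
Lemma tri_inv_calX (Q : {poly R}) x (H : nat -> R) n j : Q.[x] != 0 ->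
  (j < n)%N ->
  \sum_(r < n) tri_inv (tri_horner Q (strmx (calX x))) j r *
     (\sum_(l < r.+1) (deriv_mx Q r l).[x] * H l) = H j.
Proof.
move=> Q0 jn; pose A := tri_horner Q (strmx (calX x)).
have lA : lower_triangular A.
  by move=> a b ab; rewrite /A tri_horner_calXT /deriv_mx leqNgt ab /= horner0.
have dA i : A i i != 0.
  by rewrite /A tri_horner_calXT /deriv_mx leqnn subnn derivn0 binn.
have lI := tri_inv_lower lA dA.
(* The sequence [H] as a column, in order to use associativity of products. *)
pose B : smx R := fun l _ => H l.
have <- : lmul (lmul (tri_inv A) A) B j 0%N = H j.
  by rewrite lmul1// => a b; exact: lmul_tri_invl.
rewrite lmulA// (lmul_widen _ _ lI jn); apply: eq_bigr => r _; congr (_ * _).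
by apply: eq_bigr => l _; rewrite -tri_horner_calXT.
Qed.

End TriangularTranspose.

(** * Growth of the entries of the inverse of Q(X) *)

Section RationalEntries.
Variable R : realType.
Local Notation T := (measurableTypeR R).
Local Open Scope classical_set_scope.

Lemma measurable_funV : measurable_fun setT (fun x : T => x^-1 : T).
Proof.
have m0 : measurable ([set 0] : set T) by exact: measurable_set1.
have <- : [set 0] `|` ~` [set 0] = [set: T] by rewrite setUv.
apply/(measurable_funU _ m0 (measurableC m0)); split.
  apply: (eq_measurable_fun (fun=> 0 : T)); last exact: measurable_cst.
  by move=> x /set_mem /= ->; rewrite invr0.
apply: open_continuous_measurable_fun.
  by apply: closed_openC; apply: accessible_closed_set1; exact: hausdorff_accessible.
move=> x /set_mem /= /eqP x0; exact: inv_continuous.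
Qed.

Lemma measurable_rational (Q p1 p2 : {poly R}) K :
  measurable_fun setT (fun x : T =>
    if Q.[x] == 0 then p1.[x] else p2.[x] / Q.[x] ^+ K : T).
Proof.
apply: measurable_fun_if => //.
- by apply: measurable_fun_eqr; [exact: measurable_poly|exact: measurable_cst].
- exact: measurable_poly.
- apply: measurable_funM; first exact: measurable_poly.
  have -> : (fun x : R => (Q.[x] ^+ K)^-1) = (fun x => x^-1) \o horner (Q ^+ K).
    by apply/funext => x /=; rewrite horner_exp.
  apply: (measurable_comp measurableT) => //; first exact: measurable_funV.
  exact: measurable_poly.
Qed.

Lemma closed_away (S : set R) (a : R) : closed S -> ~ S a ->
  exists2 e : R, 0 < e & forall x, S x -> e <= `|x - a|.
Proof.
move=> cS Sa; have := closed_openC cS; rewrite openE => /(_ a Sa).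
rewrite /interior => /nbhs_ballP[e /= e0 eS]; exists e => // x Sx.
by rewrite leNgt; apply/negP => xa; apply: (eS x) => //; rewrite /ball /= distrC.
Qed.

Variables (s : nat) (q : 'I_s -> R) (m : 'I_s -> nat).
Local Notation Q := (defQ q m).

(** Each root has a positive distance to the closed set [S]. *)
Lemma defQ_away (S : set R) : closed S -> (forall i, ~ S (q i)) ->
  exists2 C : R, 0 <= C & forall x, S x -> Q.[x] != 0 /\ `|Q.[x]|^-1 <= C.
Proof.
move=> cS Sq.
have /choice[e he] i : exists e : R, 0 < e /\ forall x, S x -> e <= `|x - q i|.
  by have [e e0 he] := closed_away cS (Sq i); exists e.
have e0 : 0 < \prod_(i < s) e i ^+ m i.
  by apply: prodr_gt0 => i _; rewrite exprn_gt0//; case: (he i).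
have le x : S x -> \prod_(i < s) e i ^+ m i <= `|Q.[x]|.
  move=> Sx; rewrite /defQ horner_prod normr_prod; apply: ler_prod => i _.
  have [ei h] := he i.
  rewrite exprn_ge0/=; last exact: ltW.
  rewrite horner_exp hornerXsubC normrX.
  by apply: lerXn2r; rewrite ?nnegrE ?h// ltW.
exists (\prod_(i < s) e i ^+ m i)^-1; first by rewrite invr_ge0 ltW.
move=> x Sx; have Q0 : 0 < `|Q.[x]| by exact: lt_le_trans (le x Sx).
by rewrite -normr_gt0; split => //; rewrite lef_pV2 ?posrE// le.
Qed.

Definition geronimus_coef (j r : nat) : T -> T :=
  fun x => tri_inv (tri_horner Q (strmx (calX x))) j r.

Lemma measurable_geronimus_coef j r :
  measurable_fun setT (geronimus_coef j r).
Proof.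
have [p1 [p2 [K E]]] := tri_inv_rational Q j r.
rewrite (_ : geronimus_coef j r = fun x : T =>
    if Q.[x] == 0 then p1.[x] else p2.[x] / Q.[x] ^+ K : T).
  exact: measurable_rational.
by apply/funext => x; exact: E.
Qed.

(** On [S] the denominator is bounded below; the roots of [Q] are finitely many
    more points, which only add a constant to the bound. *)
Lemma moderate_geronimus_coef (S : set R) j r :
  closed S -> (forall i, ~ S (q i)) ->
  moderate (S `|` [set x | exists i, x = q i]) (geronimus_coef j r).
Proof.
move=> cS Sq; split.
  by apply: measurable_funTS; exact: measurable_geronimus_coef.
have [C C0 QC] := defQ_away cS Sq.
have [p1 [p2 [K E]]] := tri_inv_rational Q j r.
exists ((p2 ^+ 2 + 1) * (C ^+ K)%:P + (\sum_(i < s) `|geronimus_coef j r (q i)|)%:P).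
have p2E (x : R) : `|p2.[x]| <= (p2 ^+ 2 + 1).[x].
  rewrite hornerD horner_exp hornerC -[p2.[x] ^+ 2]real_normK ?num_real//.
  by have := normr_ge0 p2.[x]; nra.
move=> x [Sx|[i ->]]; rewrite hornerD hornerM !hornerC.
  rewrite -[leLHS]addr0 lerD//; last by apply: sumr_ge0.
  have [Q0 Qx] := QC x Sx.
  rewrite /geronimus_coef E (negPf Q0) normrM normfV normrX -exprVn.
  rewrite ler_pM// ?exprn_ge0 ?invr_ge0//.
  by apply: lerXn2r; rewrite ?nnegrE ?invr_ge0.
rewrite -[leLHS]add0r lerD//.
  by rewrite mulr_ge0 ?exprn_ge0//; apply: le_trans (p2E _).
by rewrite (bigD1 i)//= lerDl sumr_ge0.
Qed.

End RationalEntries.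

(** * The bilinear form of a measure matrix on sequences of derivatives *)

Section JetForm.
Variable R : realType.
Local Notation T := (measurableTypeR R).
Local Open Scope classical_set_scope.
Implicit Types (nu : signed_measure R) (V : measure_matrix R) (D : set T).

Lemma cintegral_sum nu D (I : Type) (r : seq I) (a : I -> R) (f : I -> T -> R) :
  measurable D -> (forall i, cintegrable nu D (f i)) ->
  cintegral nu D (fun x => \sum_(i <- r) a i * f i x) =
  \sum_(i <- r) a i * cintegral nu D (f i).
Proof.
move=> mD intf.
have /all_and2[ip in_] i := (integrable_charge_variation _ _ mD).1 (intf i).
have iZ (mu : {measure set T -> \bar R}) i : mu.-integrable D (EFin \o f i) ->
    mu.-integrable D (EFin \o (fun x => a i * f i x)).
  exact: integrableZl.
rewrite /cintegral.
rewrite (Rintegral_sum r mD (fun i => iZ _ i (ip i))).2.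
rewrite (Rintegral_sum r mD (fun i => iZ _ i (in_ i))).2 -sumrB.
by apply: eq_bigr => i _; rewrite !RintegralZl// mulrBr.
Qed.

Lemma eq_cintegral nu D (f g : T -> R) : (forall x, D x -> f x = g x) ->
  cintegral nu D f = cintegral nu D g.
Proof.
by move=> fg; congr (_ - _); apply: eq_Rintegral => x /set_mem; exact: fg.
Qed.

(** [D] is a common domain for all the integrals: it contains the supports, and
    functions dominated by polynomials on [D] are integrable. *)
Definition tame V D := forall n r, csupport (V n r) `<=` D /\
  forall f, moderate D f -> cintegrable (V n r) D f.

(** The bilinear form, evaluated on sequences that stand for the successive
    derivatives of two functions.  The Leibniz rule then acts on one argument of
    the form, and only values on the supports enter, away from the pole of the
    Cauchy kernel. *)
Definition Lform V (f h : nat -> T -> R) :=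
  \sum_(n < (mm_order V).+1) \sum_(r < (mm_order V).+1)
    cintegral (V n r) (csupport (V n r)) (fun x => f n x * h r x).

Definition moderate_jet D (f : nat -> T -> R) := forall n, moderate D (f n).

Section Tame.
Variables (V : measure_matrix R) (D : set T).
Hypotheses (cD : closed (D : set R)) (tV : tame V D).

Let mD : measurable D. Proof. exact: closed_measurable. Qed.

Lemma tame_cintegral n r (f : T -> R) : moderate D f ->
  cintegral (V n r) (csupport (V n r)) f = cintegral (V n r) D f.
Proof.
have [sD iD] := tV n r.
by move=> mf; apply: cintegral_csupport => //; exact: iD.
Qed.

Lemma eq_Lform f f' h h' :
  (forall n x, D x -> f n x = f' n x) -> (forall n x, D x -> h n x = h' n x) ->
  Lform V f h = Lform V f' h'.
Proof.
move=> ff hh; apply: eq_bigr => n _; apply: eq_bigr => r _.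
by apply: eq_cintegral => x /(tV n r).1 Dx; rewrite ff// hh.
Qed.

Lemma Lform_sumr (I : Type) (s : seq I) (a : I -> R) (f : nat -> T -> R)
    (h : I -> nat -> T -> R) :
  moderate_jet D f -> (forall i, moderate_jet D (h i)) ->
  Lform V f (fun r x => \sum_(i <- s) a i * h i r x) =
  \sum_(i <- s) a i * Lform V f (h i).
Proof.
move=> mf mh; rewrite /Lform.
under [RHS]eq_bigr do rewrite mulr_sumr.
rewrite [RHS]exchange_big; apply: eq_bigr => n _ /=.
under [RHS]eq_bigr do rewrite mulr_sumr.
rewrite [RHS]exchange_big; apply: eq_bigr => r _ /=.
have mfh i : moderate D (fun x => f n x * h i r x).
  by apply: moderateM; [exact: mf|exact: mh].
rewrite (@eq_cintegral _ _ _ (fun x => \sum_(i <- s) a i * (f n x * h i r x))).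
  rewrite tame_cintegral; last by apply: moderate_sum => i; exact: moderateZ.
  rewrite cintegral_sum//; last by move=> i; apply: (tV n r).2.
  by apply: eq_bigr => i _; rewrite tame_cintegral.
by move=> x _; rewrite mulr_sumr; apply: eq_bigr => i _; rewrite mulrCA.
Qed.

Lemma Lform_suml (I : Type) (s : seq I) (a : I -> R) (f : I -> nat -> T -> R)
    (h : nat -> T -> R) :
  (forall i, moderate_jet D (f i)) -> moderate_jet D h ->
  Lform V (fun r x => \sum_(i <- s) a i * f i r x) h =
  \sum_(i <- s) a i * Lform V (f i) h.
Proof.
move=> mf mh; rewrite /Lform.
under [RHS]eq_bigr do rewrite mulr_sumr.
rewrite [RHS]exchange_big; apply: eq_bigr => n _ /=.
under [RHS]eq_bigr do rewrite mulr_sumr.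
rewrite [RHS]exchange_big; apply: eq_bigr => r _ /=.
have mfh i : moderate D (fun x => f i n x * h r x).
  by apply: moderateM; [exact: mf|exact: mh].
rewrite (@eq_cintegral _ _ _ (fun x => \sum_(i <- s) a i * (f i n x * h r x))).
  rewrite tame_cintegral; last by apply: moderate_sum => i; exact: moderateZ.
  rewrite cintegral_sum//; last by move=> i; apply: (tV n r).2.
  by apply: eq_bigr => i _; rewrite tame_cintegral.
by move=> x _; rewrite mulr_suml; apply: eq_bigr => i _; rewrite mulrA.
Qed.

End Tame.

(** Finiteness of the form on polynomials only mentions products of derivatives;
    antiderivatives extract from it the moments of each single measure. *)
Lemma antiderivative n (p : {poly R}) : exists P : {poly R}, derivn n P = p.
Proof.
elim: n p => [|n IH] p; first by exists p; rewrite derivn0.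
have [P PE] := IH p.
exists (\poly_(i < (size P).+1) (P`_i.-1 / i%:R)).
rewrite derivSn -PE; congr derivn; apply/polyP => i.
rewrite coef_deriv coef_poly ltnS; case: ltnP => iP.
  by rewrite -[LHS]mulr_natr divfK// pnatr_eq0.
by rewrite mul0rn nth_default.
Qed.

Section MeasureMatrix.
Variables (W : measure_matrix R) (s : nat) (q : 'I_s -> R).
Hypothesis mmW : is_measure_matrix W.

Lemma csupport_order n r : (mm_order W < n)%N || (mm_order W < r)%N ->
  csupport (W n r) = set0.
Proof. by move=> nr; apply: csupport_null; exact: mmW.1. Qed.

Lemma closed_mm_support : closed (mm_support W).
Proof.
have -> : mm_support W = \bigcup_(p in `I_(mm_order W).+1 `*` `I_(mm_order W).+1)
    (csupport (W p.1 p.2) : set R).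
  apply/seteqP; split => [x [n [r nr]]|x [[n r] _ nr]]; last by exists n, r.
  exists (n, r) => //; split => /=; rewrite ltnS leqNgt; apply/negP => no.
    by move: nr; rewrite csupport_order ?no.
  by move: nr; rewrite csupport_order ?no ?orbT.
apply: closed_bigcup => [|p _]; last exact: csupport_closed.
by apply: finite_setX; exact: finite_II.
Qed.

(** The points where the masses are added are included, so that the measures
    before and after the deformation live on the same set. *)
Definition domain : set T := mm_support W `|` [set x | exists i, x = q i].

Lemma closed_domain : closed (domain : set R).
Proof.
apply: closedU; first exact: closed_mm_support.
have -> : [set x : R | exists i, x = q i] = \bigcup_(i in [set: 'I_s]) [set q i].
  by apply/seteqP; split => [x [i ->]|x [i _ ->]]; exists i.
apply: closed_bigcup => [|i _]; first exact: finite_finset.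
by apply: accessible_closed_set1; exact: hausdorff_accessible.
Qed.

Lemma tame_measure_matrix : tame W domain.
Proof.
move=> n r; have SD : csupport (W n r) `<=` domain.
  by move=> x nr; left; exists n, r.
have mD : measurable domain by apply: closed_measurable; exact: closed_domain.
have mS := csupport_measurable (W n r).
split=> // f [mf [p fp]].
apply/(cintegrable_csupport mD SD mf).
have [P PE] := antiderivative n p; have [P1 P1E] := antiderivative r 1.
have := mmW.2 P P1 n r; rewrite PE P1E => ip.
apply: (le_integrable mS _ _ ip).
  by apply/measurable_EFinP; apply: measurable_funS mf.
move=> x Sx; rewrite /= lee_fin hornerC mulr1.
by apply: le_trans (fp x (SD _ Sx)) _; exact: ler_norm.
Qed.

End MeasureMatrix.
End JetForm.

(** * The right deformation undoes the multiplication by Q *)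

Section GeronimusForm.
Variable R : realType.
Local Notation T := (measurableTypeR R).
Local Open Scope classical_set_scope.
Local Open Scope ring_scope.
Variables (W : measure_matrix R) (s : nat) (q : 'I_s -> R) (m : 'I_s -> nat).
Variable xi : forall i : 'I_s, 'M[R]_(m i).
Hypothesis mmW : is_measure_matrix W.
Hypothesis qW : forall i, ~ mm_support W (q i).
Local Notation Q := (defQ q m).
Local Notation WR := (geronimusR q xi W).
Local Notation D := (domain W q).

(** The derivatives of the product of the polynomial [p] with a function whose
    derivatives are [h]. *)
Definition jetmul (p : {poly R}) (h : nat -> T -> R) (r : nat) (x : T) : R :=
  \sum_(l < r.+1) (deriv_mx p r l).[x] * h l x.

Lemma moderate_jetmul (E : set T) p h :
  moderate_jet E h -> moderate_jet E (jetmul p h).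
Proof.
move=> mh r; apply: moderate_sum => l; apply: moderateM; last exact: mh.
exact: moderate_horner.
Qed.

(** One factor is lost at each derivation. *)
Lemma derivn_multiple_root (a : R) k n (p : {poly R}) : (k < n)%N ->
  (derivn k (('X - a%:P) ^+ n * p)).[a] = 0.
Proof.
elim: k n p => [|k IH] [//|n] p; rewrite ltnS => kn.
  by rewrite derivn0 exprS !hornerM hornerXsubC subrr !mul0r.
rewrite derivSn derivM deriv_exp derivXsubC mul1r /=.
have -> : ('X - a%:P) ^+ n *+ n.+1 * p + ('X - a%:P) ^+ n.+1 * p^`() =
    ('X - a%:P) ^+ n * (p *+ n.+1 + ('X - a%:P) * p^`()).
  move: ('X - a%:P) => Y.
  by rewrite exprSr mulrDr mulrA mulrnAl mulrnAr.
exact: IH.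
Qed.

Lemma defQ_derivn0 i k : (k < m i)%N -> (derivn k Q).[q i] = 0.
Proof. by move=> km; rewrite /defQ (bigD1 i)//= derivn_multiple_root. Qed.

Lemma jetmul_root h i r : (r < m i)%N -> jetmul Q h r (q i) = 0.
Proof.
move=> rm; apply: big1 => l _; rewrite /deriv_mx; case: ifP => _.
  by rewrite hornerMn defQ_derivn0 ?mul0rn ?mul0r// (leq_ltn_trans (leq_subr _ _)).
by rewrite horner0 mul0r.
Qed.

Lemma mx_ext_out k (A : 'M[R]_k) n r : (k <= r)%N -> mx_ext A n r = 0.
Proof.
move=> kr; rewrite /mx_ext; case: insub => // a.
by rewrite insubF// ltnNge kr.
Qed.

Lemma qD i : D (q i). Proof. by right; exists i. Qed.

Let entry n r (f : T -> R) : csupport (WR n r) `<=` D /\ (moderate D f ->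
  cintegrable (WR n r) D f /\
  cintegral (WR n r) D f =
    \sum_(j < (mm_order W).+1)
       cintegral (W n j) D (fun x => geronimus_coef q m j r x * f x)
    + \sum_(i < s) mx_ext (xi i) n r * f (q i)).
Proof.
have cD : closed (D : set R) by exact: closed_domain.
have tW : tame W D by exact: tame_measure_matrix.
have mc (j : 'I_(mm_order W).+1) := measurable_geronimus_coef q m j r.
split.
  exact: (@csupport_entry _ _ _ (fun j : 'I_(mm_order W).+1 => W n j)
    (fun j => geronimus_coef q m j r) (fun i => mx_ext (xi i) n r) q D cD
    (fun j => (tW n j).1) qD).
apply: (@cintegral_entry _ _ _ (fun j : 'I_(mm_order W).+1 => W n j)
    (fun j => geronimus_coef q m j r) (fun i => mx_ext (xi i) n r) q D cD
    (fun j => (tW n j).1) qD (fun j => (tW n j).2) mc).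
by move=> j; apply: moderate_geronimus_coef => //; exact: closed_mm_support.
Qed.

Lemma tame_geronimusR : tame WR D.
Proof.
move=> n r; split; first exact: (entry n r (fun=> 0)).1.
by move=> f mf; exact: ((entry n r f).2 mf).1.
Qed.

(** Inside the support of the original measures the inverse of [Q(X)] cancels
    the multiplication by [Q]; at the added masses the product with [Q] has
    zeros of sufficient order. *)
Lemma Lform_geronimusR f h : moderate_jet D f -> moderate_jet D h ->
  Lform WR f (jetmul Q h) = Lform W f h.
Proof.
move=> mf mh; have mQh := moderate_jetmul Q mh.
have cD : closed (D : set R) by exact: closed_domain.
have mD : measurable D by exact: closed_measurable.
have tW : tame W D by exact: tame_measure_matrix.
rewrite /Lform; set o := mm_order W; set o' := mm_order WR.
have oo' : (o <= o')%N by rewrite leq_maxl.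
pose c j r := geronimus_coef q m j r.
have mc j r : moderate D (c j r).
  by apply: moderate_geronimus_coef => //; exact: closed_mm_support.
(* The point masses do not contribute: they meet zeros of [Q h]. *)
have E n r : cintegral (WR n r) (csupport (WR n r)) (fun x => f n x * jetmul Q h r x)
    = \sum_(j < o.+1) cintegral (W n j) D (fun x => c j r x * (f n x * jetmul Q h r x)).
  have mfh : moderate D (fun x => f n x * jetmul Q h r x) by exact: moderateM.
  rewrite (tame_cintegral cD tame_geronimusR)//.
  rewrite ((entry n r _).2 mfh).2 [X in _ + X]big1 ?addr0// => i _.
  case: (ltnP r (m i)) => rm; last by rewrite mx_ext_out ?mul0r.
  by rewrite jetmul_root// !mulr0.
(* The range of [r] contains the whole row [j] of the lower triangular
   inverse, since the deformed order is not less than the original one. *)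
have E2 n (j : 'I_o.+1) : \sum_(r < o'.+1)
    cintegral (W n j) D (fun x => c j r x * (f n x * jetmul Q h r x)) =
    cintegral (W n j) (csupport (W n j)) (fun x => f n x * h j x).
  transitivity (cintegral (W n j) D
      (fun x => \sum_(r < o'.+1) 1 * (c j r x * (f n x * jetmul Q h r x)))).
    rewrite cintegral_sum//.
      by apply: eq_bigr => r _; rewrite mul1r.
    by move=> r; apply: (tW n j).2; apply: moderateM => //; exact: moderateM.
  rewrite -(tame_cintegral cD tW); last first.
    apply: moderate_sum => r; apply: moderateZ; apply: moderateM => //.
    exact: moderateM.
  apply: eq_cintegral => x Sx.
  have Q0 : Q.[x] != 0.
    have [C _ QC] := defQ_away m (closed_mm_support mmW) qW.
    by have [] := QC x (ex_intro _ (n : nat) (ex_intro _ (j : nat) Sx)).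
  have jo : (j < o'.+1)%N by apply: leq_trans (ltn_ord j) _.
  rewrite -[in RHS](tri_inv_calX (fun l => h l x) Q0 jo) mulr_sumr.
  by apply: eq_bigr => r _; rewrite mul1r /c /geronimus_coef /jetmul mulrCA.
under eq_bigr => n _.
  under eq_bigr => r _ do rewrite E.
  rewrite exchange_big /=.
  under eq_bigr => j _ do rewrite E2.
  over.
(* Rows beyond the order of [W] carry no measure. *)
rewrite [RHS](big_ord_widen o'.+1 (fun n => \sum_(r < o.+1)
  cintegral (W n r) (csupport (W n r)) (fun x => f n x * h r x)))//.
rewrite [RHS]big_mkcond; apply: eq_bigr => n _; case: ltnP => // on.
apply: big1 => r _; rewrite csupport_order// ?on//.
by rewrite /cintegral !Rintegral_set0 subrr.
Qed.

End GeronimusForm.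

(** * Polynomials *)

Section PolynomialJets.
Variable R : realType.
Local Notation T := (measurableTypeR R).
Implicit Types (p r : {poly R}) (V : measure_matrix R).

Definition pjet p : nat -> T -> R := fun n x => (p^`(n)).[x].

Lemma derive1n_horner p n : ((horner p)^`(n))%classic = horner (p^`(n)).
Proof. by elim: n => // n IH; rewrite derive1nS IH derivnS derivE. Qed.

Lemma moderate_pjet (D : set T) p : moderate_jet D (pjet p).
Proof. by move=> n; exact: moderate_horner. Qed.

Lemma sform_horner V p r : sform V (horner p) (horner r) = Lform V (pjet p) (pjet r).
Proof.
apply: eq_bigr => n _; apply: eq_bigr => l _; apply: eq_cintegral => x _.
by rewrite !derive1n_horner.
Qed.

Lemma jetmul_pjet p r : jetmul p (pjet r) = pjet (p * r).
Proof.
apply/funext => n; apply/funext => x; rewrite /pjet derivn_mul horner_sum.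
apply: eq_bigr => l _; rewrite /deriv_mx -ltnS ltn_ord.
by rewrite !hornerMn hornerM mulrnAl.
Qed.

Lemma pjet_coef p n x : pjet p n x = \sum_(i < size p) p`_i * pjet 'X^i n x.
Proof.
rewrite /pjet -{1}[p]coefK poly_def raddf_sum horner_sum.
by apply: eq_bigr => i _; rewrite /= derivnZ hornerZ.
Qed.

Lemma gramE V i j : gram V i j = Lform V (pjet 'X^i) (pjet 'X^j).
Proof.
by rewrite -sform_horner /gram; congr sform; apply/funext => x; rewrite hornerXn.
Qed.

Lemma Lform_pjet V (D : set T) p r : closed (D : set R) -> tame V D ->
  Lform V (pjet p) (pjet r) = form (gram V) p r.
Proof.
move=> cD tV.
rewrite (eq_Lform tV (f' := fun n x => \sum_(i < size p) p`_i * pjet 'X^i n x)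
  (h' := fun n x => \sum_(i < size r) r`_i * pjet 'X^i n x)); last 2 first.
- by move=> n x _; exact: pjet_coef.
- by move=> n x _; exact: pjet_coef.
have mX i := moderate_pjet D ('X^i).
rewrite (Lform_suml cD tV)//; last first.
  by move=> n; apply: moderate_sum => i; apply: moderateZ; exact: mX.
apply: eq_bigr => i _; rewrite (Lform_sumr cD tV)// mulr_sumr.
by apply: eq_bigr => j _; rewrite gramE mulrA.
Qed.

End PolynomialJets.

(** * Derivatives of the Cauchy kernel *)

Section CauchyJets.
Variable R : realType.
Local Notation T := (measurableTypeR R).
Local Open Scope classical_set_scope.
Local Open Scope ring_scope.

(** The [n]th derivative with respect to [t] of the Cauchy kernel [1 / (y - t)]. *)
Definition cjet (y : R[i]) (n : nat) (t : T) : R[i] :=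
  n`!%:R * ((y - t%:C)^-1) ^+ n.+1.

Section Pole.
Variables yr yi : R.
Local Notation y := (yr +i* yi).

(** The squared distance from [t] to the pole. *)
Definition dist2 (t : R) : R := (yr - t) ^+ 2 + yi ^+ 2.

Lemma dist2_eq0 (t : R) : (dist2 t == 0) = (y == t%:C).
Proof.
rewrite /dist2 paddr_eq0 ?sqr_ge0// !sqrf_eq0 subr_eq0 eq_complex /=.
by rewrite eq_sym.
Qed.

Lemma cauchyE (t : R) :
  (y - t%:C)^-1 = ((yr - t) / dist2 t) +i* (- yi / dist2 t).
Proof.
have -> : y - t%:C = (yr - t) +i* yi by simpc.
by rewrite {1}/GRing.inv /= /dist2 mulNr.
Qed.

(** Real and imaginary parts of the relation [w' = w ^ 2] for
    [w = 1 / (y - t)]. *)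
Lemma is_derive_cauchy (t : R) : dist2 t != 0 ->
  let A u := complex.Re ((y - u%:C)^-1) in
  let B u := complex.Im ((y - u%:C)^-1) in
  is_derive t 1 (A : R -> R) (A t ^+ 2 - B t ^+ 2) /\
  is_derive t 1 (B : R -> R) (A t * B t *+ 2).
Proof.
move=> d0 A B.
have dE : dist2 = horner ((yr%:P - 'X) ^+ 2 + (yi ^+ 2)%:P).
  by apply/funext => u; rewrite !hornerE.
have dd : is_derive t 1 dist2 (- (yr - t) *+ 2).
  rewrite dE; apply: is_derive_eq.
  by rewrite derivD derivC deriv_exp derivB derivC derivX !hornerE /=; ring.
have dn : is_derive t 1 (fun u : R => yr - u) (- 1).
  have -> : (fun u : R => yr - u) = horner (yr%:P - 'X).
    by apply/funext => u; rewrite !hornerE.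
  by apply: is_derive_eq; rewrite derivB derivC derivX !hornerE; ring.
have dV := is_deriveV d0 dd.
have AE : A = (fun u : R => yr - u) * (fun u => (dist2 u)^-1).
  by apply/funext => u; rewrite /A cauchyE.
have BE : B = (fun u : R => - yi) * (fun u => (dist2 u)^-1).
  by apply/funext => u; rewrite /B cauchyE.
have At : A t = (yr - t) / dist2 t by rewrite /A cauchyE.
have Bt : B t = - yi / dist2 t by rewrite /B cauchyE.
have dt : dist2 t = (yr - t) ^+ 2 + yi ^+ 2 by [].
split.
  rewrite [X in is_derive _ _ X]AE; have := is_deriveM dn dV.
  move=> h; apply: (is_derive_eq h); rewrite At Bt /GRing.scale /= dt.
  by field; rewrite -dt.
rewrite [X in is_derive _ _ X]BE; have := is_deriveM (is_derive_cst (- yi) t 1) dV.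
move=> h; apply: (is_derive_eq h); rewrite At Bt /GRing.scale /= dt.
by field; rewrite -dt.
Qed.

(** Real and imaginary parts of [(w ^ k)' = k w ^ (k + 1)], by induction on [k]
    through the product [w ^ k * w]. *)
Lemma is_derive_cauchyX k (t : R) : dist2 t != 0 ->
  let U k u := complex.Re ((y - u%:C)^-1 ^+ k) in
  let V k u := complex.Im ((y - u%:C)^-1 ^+ k) in
  is_derive t 1 (U k : R -> R) (k%:R * U k.+1 t) /\
  is_derive t 1 (V k : R -> R) (k%:R * V k.+1 t).
Proof.
move=> d0 U V.
pose A (u : R) : R := complex.Re ((y - u%:C)^-1).
pose B (u : R) : R := complex.Im ((y - u%:C)^-1).
have [dA dB] : is_derive t 1 A (A t ^+ 2 - B t ^+ 2) /\
  is_derive t 1 B (A t * B t *+ 2) := is_derive_cauchy d0.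
have US k' u : U k'.+1 u = U k' u * A u - V k' u * B u.
  by rewrite /U /V /A /B exprSr; case: (_ ^+ k') => ? ?; case: (_^-1).
have VS k' u : V k'.+1 u = U k' u * B u + V k' u * A u.
  by rewrite /U /V /A /B exprSr; case: (_ ^+ k') => ? ?; case: (_^-1).
elim: k => [|k [IHU IHV]].
  rewrite !mul0r; split.
    have -> : U 0 = cst 1 by [].
    exact: is_derive_cst.
  have -> : V 0 = cst 0 by [].
  exact: is_derive_cst.
split.
  have -> : U k.+1 = U k * A - V k * B by apply/funext => u; exact: US.
  have h := is_deriveB (is_deriveM IHU dA) (is_deriveM IHV dB).
  apply: (is_derive_eq h); rewrite /GRing.scale /= !(US, VS) -natr1.
  by ring.
have -> : V k.+1 = U k * B + V k * A by apply/funext => u; exact: VS.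
have h := is_deriveD (is_deriveM IHU dB) (is_deriveM IHV dA).
apply: (is_derive_eq h); rewrite /GRing.scale /= !(US, VS) -natr1.
by ring.
Qed.

Lemma continuous_dist2 : continuous dist2.
Proof.
have -> : dist2 = horner ((yr%:P - 'X) ^+ 2 + (yi ^+ 2)%:P).
  by apply/funext => u; rewrite !hornerE.
exact: continuous_horner.
Qed.

Lemma open_off_pole : open [set t : R | dist2 t != 0].
Proof.
rewrite (_ : mkset _ = dist2 @^-1` [set x | x != 0]); last by [].
by apply: open_comp; [move=> *; exact: continuous_dist2|exact: open_neq].
Qed.

Lemma is_derive_cjet n (t : R) : dist2 t != 0 ->
  is_derive t 1 ((fun u => complex.Re (cjet y n u)) : R -> R)
    (complex.Re (cjet y n.+1 t)) /\
  is_derive t 1 ((fun u => complex.Im (cjet y n u)) : R -> R)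
    (complex.Im (cjet y n.+1 t)).
Proof.
move=> d0; have [dU dV] := is_derive_cauchyX n.+1 d0.
have RE (k : nat) (z : R[i]) : complex.Re (k%:R * z) = k%:R * complex.Re z.
  by rewrite !mulr_natl raddfMn.
have IE (k : nat) (z : R[i]) : complex.Im (k%:R * z) = k%:R * complex.Im z.
  by rewrite !mulr_natl raddfMn.
have dc : is_derive t 1 (cst n`!%:R : R -> R) 0 by exact: is_derive_cst.
split.
  have -> : (fun u => complex.Re (cjet y n u)) =
      cst n`!%:R * (fun u => complex.Re ((y - u%:C)^-1 ^+ n.+1)) :> (R -> R).
    by apply/funext => u; rewrite /cjet RE.
  apply: (is_derive_eq (is_deriveM dc dU)).
  by rewrite /cjet RE scaler0 addr0 factS natrM /GRing.scale /=; ring.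
have -> : (fun u => complex.Im (cjet y n u)) =
    cst n`!%:R * (fun u => complex.Im ((y - u%:C)^-1 ^+ n.+1)) :> (R -> R).
  by apply/funext => u; rewrite /cjet IE.
apply: (is_derive_eq (is_deriveM dc dV)).
by rewrite /cjet IE scaler0 addr0 factS natrM /GRing.scale /=; ring.
Qed.

(** Derivatives are only known away from the pole; the next one is still
    determined there because this set is open. *)
Lemma derive1n_cauchy n (t : R) : dist2 t != 0 ->
  ((fun u : R => complex.Re (Defs.cauchy y u))^`(n))%classic t =
      complex.Re (cjet y n t) /\
  ((fun u : R => complex.Im (Defs.cauchy y u))^`(n))%classic t =
      complex.Im (cjet y n t).
Proof.
elim: n t => [|n IH] t d0.
  by rewrite !derive1n0 /cjet fact0 mul1r expr1 /Defs.cauchy.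
rewrite !derive1nS !derive1E.
have [dU dV] := is_derive_cjet n d0.
have near_eq : \forall u \near t, dist2 u != 0.
  by apply: open_nbhs_nbhs; split; [exact: open_off_pole|exact: d0].
split; apply: derive_val.
  apply: near_eq_is_derive dU.
  by near=> u; apply/esym; have [] := IH u; first by near: u.
apply: near_eq_is_derive dV.
by near=> u; apply/esym; have [] := IH u; first by near: u.
Unshelve. all: by end_near. Qed.

Variable D : set T.
Hypothesis cD : closed (D : set R).
Hypothesis yD : forall t, D t -> dist2 t != 0.

(** If [y] is not real its imaginary part bounds the distance from below;
    otherwise [y] is a real point off the closed set [D]. *)
Lemma dist2_away : exists2 C : R, 0 < C & forall t, D t -> C <= dist2 t.
Proof.
have [yi0|yi0] := eqVneq yi 0; last first.
  exists (yi ^+ 2); first by rewrite exprn_even_gt0.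
  by move=> t _; rewrite /dist2 lerDr sqr_ge0.
have Dy : ~ D yr.
  by move/yD; rewrite /dist2 subrr yi0 expr0n addr0 eqxx.
have [e e0 he] := closed_away cD Dy; exists (e ^+ 2); first by rewrite exprn_gt0.
move=> t Dt; rewrite /dist2 yi0 expr0n addr0 -[leRHS]real_normK ?num_real//.
by rewrite distrC; apply: lerXn2r; rewrite ?nnegrE ?he// ltW.
Qed.

(** The kernel is bounded on [D]; powers are products, taken apart into real and
    imaginary parts. *)
Lemma moderate_cauchyX k :
  moderate D (fun t => complex.Re ((y - t%:C)^-1 ^+ k)) /\
  moderate D (fun t => complex.Im ((y - t%:C)^-1 ^+ k)).
Proof.
have [C C0 hC] := dist2_away.
have mV : moderate D (fun t => (dist2 t)^-1).
  split.
    apply: (measurable_comp (F := setT)) => //; first exact: measurable_funV.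
    apply: measurable_funTS; apply: continuous_measurable_fun.
    exact: continuous_dist2.
  exists (C^-1)%:P => t Dt; have dt := lt_le_trans C0 (hC t Dt).
  by rewrite hornerC ger0_norm ?invr_ge0 ?(ltW dt)// lef_pV2 ?posrE// hC.
have mA : moderate D (fun t => complex.Re ((y - t%:C)^-1)).
  apply: (eq_moderate (f := fun t => (yr%:P - 'X).[t] * (dist2 t)^-1)).
    by move=> t _; rewrite cauchyE /= !hornerE.
  by apply: moderateM => //; exact: moderate_horner.
have mB : moderate D (fun t => complex.Im ((y - t%:C)^-1)).
  apply: (eq_moderate (f := fun t => - yi * (dist2 t)^-1)).
    by move=> t _; rewrite cauchyE.
  exact: moderateZ.
elim: k => [|k [IHU IHV]]; first by split; exact: moderate_cst.
split.
  apply: (eq_moderate (f := fun t =>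
    complex.Re ((y - t%:C)^-1 ^+ k) * complex.Re ((y - t%:C)^-1) +
    (-1) * (complex.Im ((y - t%:C)^-1 ^+ k) * complex.Im ((y - t%:C)^-1)))).
    by move=> t _; rewrite exprSr mulN1r; case: (_ ^+ k) => ? ?; case: (_^-1).
  by apply: moderateD; [exact: moderateM|apply: moderateZ; exact: moderateM].
apply: (eq_moderate (f := fun t =>
    complex.Re ((y - t%:C)^-1 ^+ k) * complex.Im ((y - t%:C)^-1) +
    complex.Im ((y - t%:C)^-1 ^+ k) * complex.Re ((y - t%:C)^-1))).
  by move=> t _; rewrite exprSr; case: (_ ^+ k) => ? ?; case: (_^-1).
by apply: moderateD; exact: moderateM.
Qed.

Lemma moderate_cjet :
  moderate_jet D (fun n t => complex.Re (cjet y n t)) /\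
  moderate_jet D (fun n t => complex.Im (cjet y n t)).
Proof.
split=> n; have [mU mV] := moderate_cauchyX n.+1.
  apply: eq_moderate (moderateZ n`!%:R mU) => t _.
  by rewrite /cjet !mulr_natl raddfMn.
apply: eq_moderate (moderateZ n`!%:R mV) => t _.
by rewrite /cjet !mulr_natl raddfMn.
Qed.

End Pole.
End CauchyJets.

(** * The Cauchy kernel multiplied by Q, and the Bezout polynomial *)

Section CauchyIdentity.
Variables (R : realType) (Q : {poly R}) (N : nat) (y : R[i]).
Hypothesis sQ : (size Q <= N.+1)%N.
Local Notation Qc := (map_poly (real_complex R) Q).

(** The coefficient of [x ^ j] in [(Q(y) - Q(x)) / (y - x)]. *)
Definition bezout_coef (j : nat) : R[i] :=
  \sum_(i < N) (Q`_(i + j).+1)%:C * y ^+ i.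

Let Q_out n : (N < n)%N -> Q`_n = 0.
Proof. by move=> Nn; rewrite nth_default// (leq_trans sQ). Qed.

Lemma bezout_coef_out j : (N <= j)%N -> bezout_coef j = 0.
Proof.
move=> Nj; apply: big1 => i _; rewrite Q_out ?mul0r// ltnS.
by rewrite (leq_trans Nj)// leq_addl.
Qed.

Lemma bezout_coefS j : bezout_coef j = (Q`_j.+1)%:C + y * bezout_coef j.+1.
Proof.
have -> : y * bezout_coef j.+1 = \sum_(i < N) (Q`_(i.+1 + j).+1)%:C * y ^+ i.+1.
  rewrite mulr_sumr; apply: eq_bigr => i _.
  by rewrite exprS addnS addSn mulrCA.
have -> : (Q`_j.+1)%:C = (Q`_(0 + j).+1)%:C * y ^+ 0 by rewrite mulr1.
rewrite -(big_ord_recl N (fun i => (Q`_(i + j).+1)%:C * y ^+ i)).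
by rewrite big_ord_recr /= Q_out ?mul0r ?addr0// ltnS leq_addr.
Qed.

Lemma horner_bezout_coef : Qc.[y] = (Q`_0)%:C + y * bezout_coef 0.
Proof.
have sQc : (size Qc <= N.+1)%N by rewrite size_map_poly.
rewrite (horner_coef_wide _ sQc) big_ord_recl coef_map mulr1; congr (_ + _).
rewrite mulr_sumr; apply: eq_bigr => i _.
by rewrite coef_map /= /bump addn0 add1n exprS mulrCA.
Qed.

Definition bezout_poly : {poly R[i]} := \poly_(j < N) bezout_coef j.

(** That is, [(y - X) * bezout_poly = Q(y) - Q(X)], coefficient by
    coefficient. *)
Lemma bezout_polyE : bezout_poly * 'X + Qc.[y]%:P = y *: bezout_poly + Qc.
Proof.
apply/polyP => j; rewrite !coefD coefMX coefC coefZ coef_map !coef_poly /=.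
have bE l : (if (l < N)%N then bezout_coef l else 0) = bezout_coef l.
  by case: ltnP => // /bezout_coef_out ->.
case: j => [|j] /=; rewrite !bE.
  by rewrite add0r horner_bezout_coef addrC.
by rewrite addr0 bezout_coefS addrC.
Qed.

Variable t : R.
Hypothesis yt : y != t%:C.
Local Notation z := (y - t%:C).
Local Notation cj := (cjet y).

Let z0 : z != 0. Proof. by rewrite subr_eq0. Qed.

Lemma cjet0 : z * cj 0 t = 1.
Proof. by rewrite /cjet fact0 mul1r expr1 mulfV. Qed.

Lemma cjetS n : z * cj n.+1 t = n.+1%:R * cj n t.
Proof.
rewrite /cjet factS natrM [X in _ * (_ * X)]exprS -!mulrA mulrCA; congr (_ * _).
by rewrite mulrCA; congr (_ * _); rewrite mulrA mulfV// mul1r.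
Qed.

Lemma bezout_derivS n : z * (bezout_poly^`(n.+1)).[t%:C] =
  n.+1%:R * (bezout_poly^`(n)).[t%:C] - (Qc^`(n.+1)).[t%:C].
Proof.
have := congr1 (fun p => (derivn n.+1 p).[t%:C]) bezout_polyE.
rewrite derivnMXaddC derivnD derivnZ !hornerD hornerMn hornerMX hornerZ.
rewrite -mulr_natl => E.
have -> : (Qc^`(n.+1)).[t%:C] = n.+1%:R * (bezout_poly^`(n)).[t%:C] +
    (bezout_poly^`(n.+1)).[t%:C] * t%:C - y * (bezout_poly^`(n.+1)).[t%:C].
  by rewrite E addrC addKr.
by ring.
Qed.

(** The [n]th derivative of
    [Q(y) / (y - t) = Q(t) / (y - t) + (Q(y) - Q(t)) / (y - t)].  After
    multiplication by [y - t] the [n]th derivatives of both sides satisfy the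
    same recurrence, which avoids differentiating quotients. *)
Lemma cjet_bezout n : Qc.[y] * cj n t =
  \sum_(l < n.+1) (deriv_mx Qc n l).[t%:C] * cj l t + (bezout_poly^`(n)).[t%:C].
Proof.
apply: (mulfI z0).
elim: n => [|n IH].
  rewrite big_ord1 /deriv_mx /= ?derivn0 ?bin0 ?mulr1n mulrDr mulrCA cjet0 mulr1.
  rewrite [X in _ = X + _]mulrCA cjet0 mulr1.
  have := congr1 (fun p => p.[t%:C]) bezout_polyE.
  rewrite !hornerD hornerMX hornerZ hornerC => E.
  have -> : Qc.[y] = y * bezout_poly.[t%:C] + Qc.[t%:C] - bezout_poly.[t%:C] * t%:C.
    by rewrite -E addrC addKr.
  by ring.
have {}IH := mulfI z0 IH.
rewrite mulrCA cjetS mulrDr bezout_derivS mulrCA IH mulrDr.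
suff -> : z * (\sum_(l < n.+2) (deriv_mx Qc n.+1 l).[t%:C] * cj l t) =
    n.+1%:R * (\sum_(l < n.+1) (deriv_mx Qc n l).[t%:C] * cj l t) +
    (Qc^`(n.+1)).[t%:C] by ring.
rewrite mulr_sumr big_ord_recl mulrCA cjet0 mulr1 /deriv_mx /= ?subn0 ?bin0.
rewrite mulr1n addrC mulr_sumr; congr (_ + _); apply: eq_bigr => l _.
rewrite /bump /= add1n subSS !ltnS mulrCA cjetS.
case: ifP => _; last by rewrite !horner0 !mul0r mulr0.
rewrite !hornerMn; move: (_.[_]) (cj l t) => a c.
have E : l.+1%:R * 'C(n.+1, l.+1)%:R = n.+1%:R * 'C(n, l)%:R :> R[i].
  by rewrite -!natrM -mul_bin_diag.
rewrite -[a *+ 'C(n.+1, _)]mulr_natr -[a *+ 'C(n, _)]mulr_natr.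
transitivity (a * c * (l.+1%:R * 'C(n.+1, l.+1)%:R)); first by ring.
by rewrite E; ring.
Qed.

Lemma cjet_jetmul n : Qc.[y] * cj n t =
  \sum_(l < n.+1) ((deriv_mx Q n l).[t])%:C * cj l t +
  \sum_(j < N) bezout_coef j * (pjet 'X^j n t)%:C.
Proof.
rewrite cjet_bezout; congr (_ + _).
  apply: eq_bigr => l _; congr (_ * _); rewrite /deriv_mx.
  case: ifP => _; last by rewrite !horner0.
  by rewrite derivn_map !hornerMn horner_map /= raddfMn.
rewrite /bezout_poly poly_def raddf_sum horner_sum; apply: eq_bigr => j _.
rewrite /= derivnZ hornerZ /pjet -horner_map -derivn_map /= map_polyXn.
by [].
Qed.

End CauchyIdentity.

(** * Second kind functions of the right deformation *)

Section GeronimusRight.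
Variable R : realType.
Local Notation T := (measurableTypeR R).
Variables (W : measure_matrix R) (s : nat) (q : 'I_s -> R) (m : 'I_s -> nat).
Variable xi : forall i : 'I_s, 'M[R]_(m i).
Hypothesis mmW : is_measure_matrix W.
Hypothesis qW : forall i, ~ mm_support W (q i).
Local Notation Q := (defQ q m).
Local Notation N := (degQ m).
Local Notation WR := (geronimusR q xi W).
Local Notation D := (domain W q).

Let cD : closed (D : set R). Proof. exact: closed_domain. Qed.
Let tW : tame W D. Proof. exact: tame_measure_matrix. Qed.
Let tWR : tame WR D. Proof. exact: tame_geronimusR. Qed.

Lemma size_defQ : (size Q <= N.+1)%N.
Proof.
rewrite /defQ /degQ; elim/big_rec2: _ => [|i n p _ IH]; first by rewrite size_poly1.
apply: leq_trans (size_polyMleq _ _) _; rewrite size_exp_XsubC addSn /=.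
by rewrite -addnS leq_add2l.
Qed.

Lemma form_geronimusR p r : form (gram W) p r = form (gram WR) p (Q * r).
Proof.
rewrite -(Lform_pjet p r cD tW) -(Lform_pjet p _ cD tWR) -jetmul_pjet.
by rewrite Lform_geronimusR//; exact: moderate_pjet.
Qed.

Section SecondKind.
Variable y : R[i].
Hypothesis yD : forall t : R, D t -> y <> t%:C.

(** Second kind functions of arbitrary polynomials, so that linearity in the
    polynomial can be used; [C1] is the case of the biorthogonal family. *)
Definition second_kind (V : measure_matrix R) (p : {poly R}) : R[i] :=
  csform V (fun t => (p.[t])%:C) (Defs.cauchy y).

Lemma moderate_Re_cjet : moderate_jet D (fun n t => complex.Re (cjet y n t)).
Proof.
case: y yD => yr yi h; apply: (moderate_cjet cD _).1 => t Dt.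
by rewrite dist2_eq0; apply/eqP; exact: h.
Qed.

Lemma moderate_Im_cjet : moderate_jet D (fun n t => complex.Im (cjet y n t)).
Proof.
case: y yD => yr yi h; apply: (moderate_cjet cD _).2 => t Dt.
by rewrite dist2_eq0; apply/eqP; exact: h.
Qed.

Lemma sform0 (V : measure_matrix R) (f : R -> R) : sform V (fun=> 0) f = 0.
Proof.
apply: big1 => n _; apply: big1 => r _.
rewrite (@eq_cintegral _ _ _ _ (fun=> 0)).
  have mS := csupport_measurable (V n r).
  by rewrite /cintegral !Rintegral_cst// !mul0r subrr.
move=> x _; have -> : (fun=> 0) = horner (0 : {poly R}).
  by apply/funext => t; rewrite horner0.
by rewrite derive1n_horner linear0 horner0 mul0r.
Qed.

Lemma second_kindE V p : tame V D -> second_kind V p =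
  Lform V (pjet p) (fun n t => complex.Re (cjet y n t)) +i*
  Lform V (pjet p) (fun n t => complex.Im (cjet y n t)).
Proof.
move=> tV; rewrite /second_kind /csform /= !sform0 subr0 addr0.
have jets n t : D t ->
    ((fun u : R => complex.Re (Defs.cauchy y u))^`(n))%classic t =
      complex.Re (cjet y n t) /\
    ((fun u : R => complex.Im (Defs.cauchy y u))^`(n))%classic t =
      complex.Im (cjet y n t).
  move=> Dt; case: y yD => yr yi h; apply: derive1n_cauchy.
  by rewrite dist2_eq0; apply/eqP; exact: h.
congr (_ +i* _); apply: eq_bigr => n _; apply: eq_bigr => r _;
  apply: eq_cintegral => t /(tV n r).1 Dt; rewrite derive1n_horner.
  by rewrite (jets r t Dt).1.
by rewrite (jets r t Dt).2.
Qed.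

Lemma second_kind_sum V (tV : tame V D) n (c : nat -> R) (p : nat -> {poly R}) :
  second_kind V (\sum_(a < n) c a *: p a) =
  \sum_(a < n) (c a)%:C * second_kind V (p a).
Proof.
rewrite second_kindE//; under [RHS]eq_bigr do rewrite second_kindE//.
have E k x : pjet (\sum_(a < n) c a *: p a) k x = \sum_(a < n) c a * pjet (p a) k x.
  rewrite /pjet raddf_sum horner_sum; apply: eq_bigr => a _.
  by rewrite /= derivnZ hornerZ.
have mp (a : 'I_n) := moderate_pjet D (p a).
apply/eqP; rewrite eq_complex /= !raddf_sum /=; apply/andP; split; apply/eqP.
  rewrite (eq_Lform tV (fun k x _ => E k x) (fun _ _ _ => erefl)).
  rewrite (Lform_suml cD tV)//; last exact: moderate_Re_cjet.
  by apply: eq_bigr => a _; rewrite mul0r subr0.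
rewrite (eq_Lform tV (fun k x _ => E k x) (fun _ _ _ => erefl)).
rewrite (Lform_suml cD tV)//; last exact: moderate_Im_cjet.
by apply: eq_bigr => a _; rewrite mul0r addr0.
Qed.

Lemma Lform_lin2 (V : measure_matrix R) (tV : tame V D) f h1 h2 (a b : R) :
  moderate_jet D f -> moderate_jet D h1 -> moderate_jet D h2 ->
  Lform V f (fun n x => a * h1 n x + b * h2 n x) = a * Lform V f h1 + b * Lform V f h2.
Proof.
move=> mf m1 m2.
have := @Lform_sumr _ _ _ cD tV bool [:: true; false]
  (fun i => if i then a else b) f (fun i => if i then h1 else h2) mf.
rewrite !big_cons !big_nil addr0 => <-; last by case.
by apply: eq_Lform => // n x _; rewrite !big_cons big_nil addr0.
Qed.

(** The form is additive and homogeneous over the reals only, so that the complex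
    identity [cjet_jetmul] is split into its real and imaginary parts. *)
Lemma second_kind_geronimusR p :
  peval Q y * second_kind WR p = second_kind W p +
  \sum_(j < N) bezout_coef Q N y j * (form (gram WR) p 'X^j)%:C.
Proof.
have mp := moderate_pjet D p; have mX (j : 'I_N) := moderate_pjet D ('X^j).
have mR := moderate_Re_cjet; have mI := moderate_Im_cjet.
have id n t (Dt : D t) := cjet_jetmul size_defQ (introN eqP (yD Dt)) n.
rewrite !second_kindE//; move: id; rewrite -/(peval Q y).
set z := peval Q y => id.
pose fR n (t : T) := complex.Re (cjet y n t).
pose fI n (t : T) := complex.Im (cjet y n t).
have RealRe (x : R) (w : R[i]) : complex.Re (x%:C * w) = x * complex.Re w.
  by case: w => ? ? /=; rewrite mul0r subr0.
have RealIm (x : R) (w : R[i]) : complex.Im (x%:C * w) = x * complex.Im w.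
  by case: w => ? ? /=; rewrite mul0r addr0.
have idR n t : D t -> complex.Re z * fR n t + (- complex.Im z) * fI n t =
    1 * jetmul Q fR n t + 1 *
      \sum_(j < N) complex.Re (bezout_coef Q N y j) * pjet 'X^j n t.
  move=> /(id n) /(congr1 (@complex.Re R)); rewrite raddfD !raddf_sum !mul1r /=.
  under eq_bigr do rewrite RealRe.
  under [X in _ + X]eq_bigr do rewrite mulrC RealRe mulrC.
  rewrite -/(fR n t) => <-; rewrite mulNr /fR /fI.
  by case: (z) => ? ?; case: (cjet y n t).
have idI n t : D t -> complex.Re z * fI n t + complex.Im z * fR n t =
    1 * jetmul Q fI n t + 1 *
      \sum_(j < N) complex.Im (bezout_coef Q N y j) * pjet 'X^j n t.
  move=> /(id n) /(congr1 (@complex.Im R)); rewrite raddfD !raddf_sum !mul1r /=.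
  under eq_bigr do rewrite RealIm.
  under [X in _ + X]eq_bigr do rewrite mulrC RealIm mulrC.
  rewrite -/(fI n t) => <-; rewrite /fR /fI.
  by case: (z) => ? ?; case: (cjet y n t).
have mSum (c : 'I_N -> R) :
    moderate_jet D (fun n t => \sum_(j < N) c j * pjet 'X^j n t).
  by move=> n; apply: moderate_sum => j; apply: moderateZ; exact: mX.
have EI := eq_Lform tWR (f := pjet p) (fun _ _ _ => erefl) idI.
have ER := eq_Lform tWR (f := pjet p) (fun _ _ _ => erefl) idR.
have mQR := moderate_jetmul Q mR; have mQI := moderate_jetmul Q mI.
have LX (c : 'I_N -> R) :
    Lform WR (pjet p) (fun n t => \sum_(j < N) c j * pjet 'X^j n t) =
    \sum_(j < N) c j * form (gram WR) p 'X^j.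
  rewrite (Lform_sumr cD tWR)//.
  by apply: eq_bigr => j _; rewrite (Lform_pjet _ _ cD tWR).
rewrite !(Lform_lin2 tWR)// LX Lform_geronimusR// !mul1r in ER.
rewrite !(Lform_lin2 tWR)// LX Lform_geronimusR// !mul1r in EI.
apply/eqP; rewrite eq_complex !raddfD !raddf_sum /=.
under eq_bigr do rewrite mulrC RealRe mulrC.
under [X in _ && (_ == _ + X)]eq_bigr do rewrite mulrC RealIm mulrC.
rewrite -ER -EI -!/(fR _ _) -!/(fI _ _).
by case: (z) => a b /=; rewrite mulNr !eqxx.
Qed.

End SecondKind.
End GeronimusRight.

(** * Kernels of the right deformation *)

Section KernelsRight.
Variable R : realType.
Variables (W : measure_matrix R) (s : nat) (q : 'I_s -> R) (m : 'I_s -> nat).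
Variable xi : forall i : 'I_s, 'M[R]_(m i).
Variables (F FR : LU_data R).
Local Notation Q := (defQ q m).
Local Notation N := (degQ m).
Local Notation WR := (geronimusR q xi W).
Local Notation omega := (resolventR F FR).
Local Notation GamR := (Gamma (lu_h FR) omega N).
Hypothesis mmW : is_measure_matrix W.
Hypothesis qW : forall i, ~ mm_support W (q i).
Hypotheses (GW : LU_factorizable (gram W)) (GF : is_LU (gram W) F).
Hypotheses (GWR : LU_factorizable (gram WR)) (GFR : is_LU (gram WR) FR).

Let h0 := LU_h_neq0 GF GW.
Let hR0 := LU_h_neq0 GFR GWR.
Let sQ : (size Q <= N.+1)%N := size_defQ q m.
Let GQ := form_geronimusR xi mmW qW.

Lemma resolvent_kernel k (x : R[i]) (v : nat -> R[i]) :
  \sum_(a < k) peval (P2 FR a) x * ((lu_h FR a)^-1)%:C *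
     (\sum_(b < a.+1) (omega a b)%:C * v b) =
  peval Q x * (\sum_(j < k) peval (P2 F j) x * ((lu_h F j)^-1)%:C * v j)
  - sandwich k (fun l => peval (P2 FR l) x) (GamR k) v.
Proof.
rewrite sandwichE; last exact: (omega_banded GF GFR h0 hR0 sQ GQ).
exact: (@deformed_kernel _ _ _ _ _ _ _ GF GFR h0 hR0 sQ GQ _ (real_complex R) x k v).
Qed.

Lemma P1_resolvent a (y : R[i]) :
  peval (P1 FR a) y = \sum_(b < a.+1) (omega a b)%:C * peval (P1 F b) y.
Proof.
rewrite /P1 (omega_poly GF GFR a).
exact: (@ev_sum _ _ (real_complex R) y a.+1 (omega a)).
Qed.

Lemma kerK_geronimusR k (x y : R[i]) :
  kerK FR k x y = peval Q x * kerK F k x y -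
    sandwich k (fun l => peval (P2 FR l) x) (GamR k) (fun l => peval (P1 F l) y).
Proof.
rewrite /kerK -resolvent_kernel; apply: eq_bigr => a _.
by rewrite P1_resolvent.
Qed.

(** The condition on [k] ensures that the deformed kernel of order [k] reproduces
    the monomials of the Bezout polynomial. *)
Lemma kerK2_geronimusR k (x y : R[i]) : (N <= k)%N ->
  (forall t : R, domain W q t -> y <> t%:C) ->
  peval Q x * kerK2 W F k x y
    - sandwich k (fun l => peval (P2 FR l) x) (GamR k) (fun l => C1 W F l y)
  = peval Q y * kerK2 WR FR k x y - bezoutQ q m x y.
Proof.
move=> Nk yD; rewrite /kerK2 -resolvent_kernel.
have C1_resolvent a : \sum_(b < a.+1) (omega a b)%:C * C1 W F b y =
    peval Q y * C1 WR FR a y -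
    \sum_(j < N) bezout_coef Q N y j * (form (gram WR) (P1 FR a) 'X^j)%:C.
  apply/eqP; rewrite eq_sym subr_eq; apply/eqP.
  rewrite [LHS](second_kind_geronimusR xi mmW qW yD); congr (_ + _).
  rewrite /P1 (omega_poly GF GFR a).
  have tW : tame W (domain W q) by exact: tame_measure_matrix.
  exact: (second_kind_sum mmW yD tW a.+1 (omega a)).
under eq_bigr do rewrite C1_resolvent mulrBr.
rewrite sumrB; congr (_ - _).
  by rewrite mulr_sumr; apply: eq_bigr => a _; rewrite mulrCA.
under eq_bigr do rewrite mulr_sumr.
rewrite exchange_big /= /bezoutQ mxE.
have XE (j : 'I_N) : x ^+ j = \sum_(a < k)
    (form (gram WR) (P1 FR a) 'X^j / lu_h FR a)%:C * peval (P2 FR a) x.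
  have sX : (size ('X^j : {poly R}) <= k)%N.
    by rewrite size_polyXn (leq_trans (ltn_ord j)).
  have -> : x ^+ j = peval 'X^j x by rewrite /peval map_polyXn hornerXn.
  rewrite [in LHS](biorth_expansion GFR hR0 sX).
  exact: (@ev_sum _ _ (real_complex R) x k
    (fun a => form (gram WR) (P1 FR a) 'X^j / lu_h FR a)).
have bE : \sum_(j < N) bezout_coef Q N y j * x ^+ j =
    \sum_(j < N) \sum_(a < k) peval (P2 FR a) x * ((lu_h FR a)^-1)%:C *
      (bezout_coef Q N y j * (form (gram WR) (P1 FR a) 'X^j)%:C).
  apply: eq_bigr => j _; rewrite XE mulr_sumr; apply: eq_bigr => a _.
  by rewrite rmorphM /=; ring.
rewrite -bE.
under [RHS]eq_bigr do rewrite !mxE mulr_suml.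
rewrite [RHS]exchange_big /=; apply: eq_bigr => j _.
rewrite /bezout_coef mulr_suml; apply: eq_bigr => i _.
by rewrite !mxE addnC; ring.
Qed.

End KernelsRight.

(** * Transposition *)

Section Transposition.
Variable R : realType.
Implicit Types (W : measure_matrix R) (F : LU_data R).

Definition mm_transpose W : measure_matrix R :=
  MeasureMatrix (mm_order W) (fun n r => W r n).

Definition LU_transpose F : LU_data R := LUData (lu_S2 F) (lu_h F) (lu_S1 F).

Lemma is_measure_matrix_transpose W :
  is_measure_matrix W -> is_measure_matrix (mm_transpose W).
Proof.
move=> [W0 Wint]; split => [n r nr A mA|f h n r]; first by apply: W0; rewrite 1?orbC.
by have := Wint h f r n; congr cintegrable; apply/funext => x; rewrite mulrC.
Qed.

Lemma mm_support_transpose W t : mm_support (mm_transpose W) t <-> mm_support W t.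
Proof. by split=> -[n [r nr]]; exists r, n. Qed.

Lemma sform_transpose W f h : sform (mm_transpose W) f h = sform W h f.
Proof.
rewrite /sform exchange_big /=; apply: eq_bigr => r _; apply: eq_bigr => n _.
by apply: eq_cintegral => x _; rewrite mulrC.
Qed.

Lemma csform_transpose W f h : csform (mm_transpose W) f h = csform W h f.
Proof. by rewrite /csform !sform_transpose [X in _ +i* X]addrC. Qed.

Lemma gram_transpose W : gram (mm_transpose W) = strmx (gram W).
Proof. by apply/funext => i; apply/funext => j; rewrite /gram sform_transpose. Qed.

Lemma LU_factorizable_tr (G : smx R) : LU_factorizable G -> LU_factorizable (strmx G).
Proof. by move=> h k k0; rewrite trunc_strmx det_tr h. Qed.

(** Transposing the factorization exchanges the two unitriangular factors. *)
Lemma is_LU_tr (G : smx R) F : is_LU G F -> is_LU (strmx G) (LU_transpose F).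
Proof.
move=> GF; case: (GF) => u1 u2 GE; split => // i j; rewrite /strmx GE /=.
have l1 := lower_tri_inv_S1 GF.
have l2 : lower_triangular (tri_inv (lu_S2 F)).
  apply: tri_inv_lower; first by case: u2.
  by move=> l; exact: (unitriangular_neq0 _ u2).
have im : (i < (maxn i j).+1)%N by rewrite ltnS leq_maxl.
have jm : (j < (maxn i j).+1)%N by rewrite ltnS leq_maxr.
rewrite (lmul_widen _ _ l1 jm) (lmul_widen _ _ l2 im); apply: eq_bigr => k _.
by rewrite !lmul_sdiag mulrCA [RHS]mulrCA; congr (_ * _); rewrite mulrC.
Qed.

Lemma mx_ext_tr k (A : 'M[R]_k) n r : mx_ext A^T n r = mx_ext A r n.
Proof.
by rewrite /mx_ext; case: (insub n) (insub r) => [a|] [b|] //; rewrite mxE.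
Qed.

Section Geronimus.
Variables (s : nat) (q : 'I_s -> R) (m : 'I_s -> nat).
Variable xi : forall i : 'I_s, 'M[R]_(m i).

(** The matrix [Q(X^T)] is the transpose of [Q(X)], and the same holds for the
    inverses. *)
Lemma mm_transpose_geronimusL W :
  mm_transpose (geronimusL q xi W) = geronimusR q (fun i => (xi i)^T) (mm_transpose W).
Proof.
congr MeasureMatrix; apply/funext => n; apply/funext => r /=.
congr csum2; last by apply: eq_bigr => i _; rewrite mx_ext_tr.
apply: eq_bigr => j _; congr cdensity; apply/funext => x.
rewrite -tri_inv_strmx; apply: eq_tri_inv => a b.
by rewrite tri_horner_strmx.
Qed.

End Geronimus.

Lemma C2_transpose W F l x : C2 W F l x = C1 (mm_transpose W) (LU_transpose F) l x.
Proof. by rewrite /C1 csform_transpose. Qed.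

Lemma kerK_transpose F k x y : kerK F k x y = kerK (LU_transpose F) k y x.
Proof. by apply: eq_bigr => a _; rewrite mulrC mulrA mulrAC. Qed.

Lemma kerK1_transpose W F k x y : kerK1 W F k x y =
  kerK2 (mm_transpose W) (LU_transpose F) k y x.
Proof. by apply: eq_bigr => a _; rewrite C2_transpose mulrC mulrA mulrAC. Qed.

End Transposition.

Theorem proposition22 (R : realType) (W : measure_matrix R)
    (s : nat) (q : 'I_s -> R) (m : 'I_s -> nat)
    (xiL xiR : forall i : 'I_s, 'M[R]_(m i)) (F FL FR : LU_data R) :
  let Q := defQ q m in
  let N := degQ m in
  let WL := geronimusL q xiL W in
  let WR := geronimusR q xiR W in
  let GamL := Gamma (lu_h FL) (resolventL F FL) N in
  let GamR := Gamma (lu_h FR) (resolventR F FR) N in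
  let off_support (z : R[i]) := forall t : R,
    mm_support W t \/ (exists i, t = q i) -> z <> t%:C in
  is_measure_matrix W ->
  injective q ->
  (forall i, (0 < m i)%N) ->
  (forall i, ~ mm_support W (q i)) ->
  LU_factorizable (gram W) -> is_LU (gram W) F ->
  LU_factorizable (gram WL) -> is_LU (gram WL) FL ->
  LU_factorizable (gram WR) -> is_LU (gram WR) FR ->
  [/\ forall (k : nat) (x y : R[i]), (1 <= k)%N ->
        kerK FR k x y =
          peval Q x * kerK F k x y
          - sandwich k (fun l => peval (P2 FR l) x) (GamR k)
                       (fun l => peval (P1 F l) y),
      forall (k : nat) (x y : R[i]), (1 <= k)%N ->
        kerK FL k x y =
          peval Q y * kerK F k x y
          - sandwich k (fun l => peval (P1 FL l) y) (GamL k)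
                       (fun l => peval (P2 F l) x),
      forall (k : nat) (x y : R[i]), (N <= k)%N -> off_support y ->
        peval Q x * kerK2 W F k x y
          - sandwich k (fun l => peval (P2 FR l) x) (GamR k)
                       (fun l => C1 W F l y)
        = peval Q y * kerK2 WR FR k x y - bezoutQ q m x y
    & forall (k : nat) (x y : R[i]), (N <= k)%N -> off_support x ->
        peval Q y * kerK1 W F k x y
          - sandwich k (fun l => peval (P1 FL l) y) (GamL k)
                       (fun l => C2 W F l x)
        = peval Q x * kerK1 WL FL k x y - bezoutQ q m y x].
Proof.
move=> Q N WL WR GamL GamR off mmW _ _ qW GW GF GL GFL GR GFR.
have yD (z : R[i]) : off z -> forall t : R, domain W q t -> z <> t%:C.
  by move=> oz t; exact: oz.
have tW := is_measure_matrix_transpose mmW.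
have tqW i : ~ mm_support (mm_transpose W) (q i) by move/mm_support_transpose; exact: qW.
have tyD (z : R[i]) : off z -> forall t : R, domain (mm_transpose W) q t -> z <> t%:C.
  by move=> oz t [/mm_support_transpose Wt|tq]; apply: oz; [left|right].
have tG := LU_factorizable_tr GW; have tF := is_LU_tr GF.
have tGL := LU_factorizable_tr GL; have tFL := is_LU_tr GFL.
rewrite -gram_transpose in tG tF.
rewrite -gram_transpose mm_transpose_geronimusL in tGL tFL.
split=> [k x y _|k x y _|k x y Nk oy|k x y Nk ox].
- exact: (kerK_geronimusR mmW qW GW GF GR GFR).
- rewrite !(kerK_transpose _ _ x y).
  exact: (kerK_geronimusR tW tqW tG tF tGL tFL).
- exact: (kerK2_geronimusR mmW qW GW GF GR GFR x Nk (yD _ oy)).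
- rewrite !kerK1_transpose mm_transpose_geronimusL.
  have -> : (fun l => C2 W F l x) = (fun l => C1 (mm_transpose W) (LU_transpose F) l x).
    by apply/funext => l; exact: C2_transpose.
  exact: (kerK2_geronimusR tW tqW tG tF tGL tFL y Nk (tyD _ ox)).
Qed.
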